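(* Let $p$ be a prime, let $q$ be a power of $p$ and let $n$ be a (positive) divisor of $q-1$ such that \[ n\ge (p-1)^{1/p}\,(q-1)^{1-1/(2p)}. \] Then $n\in\mathcal{N}_p$.
   Context: For a prime $p$, $\mathcal{N}_p$ denotes the set of positive integers $n$ for which there exists a finite-dimensional non-nilpotent Lie algebra $L$, over a field of characteristic $p$, which admits a nonsingular (that is, injective) derivation of order $n$. Here the order of a nonsingular derivation $D$ is its multiplicative order as an invertible linear map of $L$, i.e. the least positive integer $n$ with $D^n=\mathrm{id}_L$.
   Formalization: The case q = 2 is excluded: there p = 2, n = 1 meets the bound with equality, but 1 is not in N_2, because a derivation of order 1 is the identity, which forces [x,y] = 2[x,y] and L abelian. No other case is removed. *)

(* Defs.v *)
From HB Require Import structures.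
From mathcomp Require Import all_boot all_order all_algebra.
From mathcomp Require Import all_classical all_reals all_analysis.

Set Implicit Arguments.
Unset Strict Implicit.
Unset Printing Implicit Defensive.

Import Order.TTheory GRing.Theory Num.Theory.

Local Open Scope ring_scope.

Record lieAlgebra (F : fieldType) := LieAlgebra {
  lie_carrier :> vectType F;
  lie_br : lie_carrier -> lie_carrier -> lie_carrier;
  lie_br_linearl : forall y, linear (lie_br^~ y);
  lie_br_linearr : forall x, linear (lie_br x);
  lie_br_alt : forall x, lie_br x x = 0;
  lie_br_jacobi : forall x y z,
    lie_br x (lie_br y z) + lie_br y (lie_br z x) + lie_br z (lie_br x y) = 0
}.

(* The bracket of two subspaces, in the style of prodv; brackv_sub shows that
   it is the least subspace containing all brackets [u, v]. *)
Definition brackv (F : fieldType) (L : lieAlgebra F) (U V : {vspace L}) :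
    {vspace L} :=
  <<[seq lie_br u v | u <- vbasis U, v <- vbasis V]>>%VS.

Fixpoint lower_central (F : fieldType) (L : lieAlgebra F) (c : nat) :
    {vspace L} :=
  if c is c'.+1 then brackv (lower_central L c') fullv else fullv.

Definition lie_nilpotent (F : fieldType) (L : lieAlgebra F) : Prop :=
  exists c, lower_central L c = 0%VS.

Definition lie_derivation (F : fieldType) (L : lieAlgebra F) (D : 'End(L)) :
    Prop :=
  forall x y, D (lie_br x y) = lie_br (D x) y + lie_br x (D y).

(* 'End(L) has no ring structure when L may be 0, hence powers as iterates. *)
Definition has_order (F : fieldType) (L : lieAlgebra F) (D : 'End(L))
    (n : nat) : Prop :=
  [/\ (0 < n)%N, iter n D =1 id &
      forall m, (0 < m < n)%N -> ~ (iter m D =1 id)].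

Definition N_ (p : nat) : set nat :=
  [set n | exists (F : fieldType) (L : lieAlgebra F) (D : 'End(L)),
     [/\ p \in [pchar F], ~ lie_nilpotent L, lie_derivation D,
         injective D & has_order D n]]%classic.

Lemma brackv_sub (F : fieldType) (L : lieAlgebra F) (U V W : {vspace L}) :
  (brackv U V <= W)%VS <->
  (forall u v, u \in U -> v \in V -> lie_br u v \in W).
Proof.
split=> [/span_subvP sUV u v uU vV|sUV]; last first.
  apply/span_subvP => _ /allpairsP[[u v] [/= uU vV ->]].
  by apply: sUV; apply: vbasis_mem.
have lin_sub (f : L -> L) (X : {vspace L}) x : linear f -> x \in X ->
    {in vbasis X, forall b, f b \in W} -> f x \in W.
  move=> f_lin xX fXW; pose g : {linear L -> L} :=
    HB.pack f (GRing.isLinear.Build _ _ _ _ f f_lin).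
  rewrite (coord_vbasis xX) -[f]/(g : _ -> _) linear_sum memv_suml // => i _.
  by rewrite linearZ memvZ //=; apply: fXW; apply: mem_nth; rewrite size_tuple.
apply: (lin_sub (fun x => lie_br x v) U u _ uU) => [|b bU]; first exact: lie_br_linearl.
apply: (lin_sub (lie_br b) V v _ vV) => [|c cV]; first exact: lie_br_linearr.
by apply: sUV; apply: allpairs_f.
Qed.

(* A derivation of order 1 is the identity, and then [x, y] = 2 [x, y], so L is
   abelian: 1 is in no N_ p.  But p = q = 2, n = 1 satisfies the bound
   n >= (p - 1)^(1/p) (q - 1)^(1 - 1/(2p)), with equality, so a theorem
   deducing n in N_ p from this bound has to exclude q = 2. *)
Lemma N_1F (p : nat) : ~ N_ p 1.
Proof.
case=> F [L] [D] [_ nnilL derD _ [_ D1 _]]; apply: nnilL; exists 1%N => /=.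
apply/eqP; rewrite -subv0; apply/brackv_sub => x y _ _; rewrite memv0.
have DE z : D z = z by apply: D1.
have := derD x y; rewrite !DE -{1}[lie_br x y]addr0 => /addrI <-; exact: eqxx.
Qed.

Lemma numeric_bound_221 (R : realType) :
  (2%:R - 1) `^ (2%:R^-1) * (2%:R - 1) `^ (1 - (2 * 2%:R)^-1) <= 1%:R :> R.
Proof.
have -> : 2%:R - 1 = 1 :> R by rewrite -[2%:R]/(1 + 1) addrK.
by rewrite !powR1 mulr1.
Qed.

(* Main.v *)
(** Let [m = (q - 1) / n].  If some [y] in [F_q] has all its translates [y + l],
    [l] in [F_p], among the [n]-th roots of unity, then the semidirect product of
    a line with [F_q^p], the line acting by a cyclic shift, has a derivation with
    eigenvalues [1] and [y + l]; a central summand adjusts its order to [n].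

    Such a [y] is found by summing over all [p]-tuples of characters of order
    dividing [m]: by Weil's bound each non-trivial tuple contributes a character
    sum of modulus at most [(p - 1) sqrt q], and the hypothesis on [n] amounts to
    [m^p (p - 1) <= sqrt (q - 1)].

    Weil's bound is obtained elementarily.  The [L]-function of the character
    tuple is a polynomial of degree less than [p], so that the character sum over
    [F_(q^r)] is minus the sum of the [r]-th powers of at most [p - 1] complex
    numbers [w].  A Stepanov argument bounds these sums by a constant times
    [q^(r/2)] for even [r], which forces [|w| <= sqrt q]. *)

Require Import Defs.
From HB Require Import structures.
From mathcomp Require Import all_boot all_order all_algebra all_field.
From mathcomp Require Import all_classical all_reals all_analysis.
From mathcomp Require Import zify ring.

Set Implicit Arguments.
Unset Strict Implicit.
Unset Printing Implicit Defensive.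

Import Order.TTheory GRing.Theory Num.Theory.
Local Open Scope ring_scope.

(** * Independence of Kummer powers *)

(** For even [r] the field [F_(q^r)] has [M^2] elements with [M = q^(r/2)], and raising to the power
    [M] is an involution of it. If [f] has coefficients in the prime field and [m n = M - 1], then
    [u = f^n] satisfies [f(X) u^m = f(X^M)], and on a class where [u^(M+1)] takes a constant value
    [c], [u^M] is [c / u]. An [M]-th power of a polynomial in [X], [X^M] and [u] thus agrees on the
    class, up to a power of [u], with a polynomial of low degree. This takes the place of the
    derivatives in the usual form of Stepanov's method: simple zeros suffice. The delicate point is
    that the auxiliary polynomial is not zero. It rests on [f(X) Z^m - f(Y)] having no factor of
    intermediate degree in [Z], and on [X^M] behaving like a new variable [Y] in low degree. The
    resulting bound for a class is [M^2 / m + O(M)], whose leading term is the expected size. The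
    implied constant depends on [m] and [f] but not on [r], and it disappears when [r] tends to
    infinity. *)

Lemma size_det_leq (R : idomainType) (N e : nat) (A : 'M[{poly R}]_N) :
  (forall i j, (size (A i j) <= e.+1)%N) -> (size (\det A) <= (N * e).+1)%N.
Proof.
move=> sA; rewrite /determinant; apply: (leq_trans (size_sum _ _ _)).
apply/bigmax_leqP => s _; rewrite size_Msign.
apply: (leq_trans (size_prod_leq _ _)).
rewrite leq_subLR card_ord addnS ltnS.
apply: (@leq_trans (\sum_(i < N) e.+1)).
  by apply: leq_sum => i _; exact: sA.
by rewrite sum_nat_const card_ord mulnS.
Qed.

(* [x] is the determinant of the companion matrix of [G], i.e. the product of
   the roots of [G]. *)
Lemma det_root_scalar (F : fieldType) (m d : nat) (c : F) (G : {poly F}) :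
  size G = d.+1 -> (0 < d)%N -> G %| 'X^m - c%:P ->
  exists x : F, x ^+ m = c ^+ d.
Proof.
move=> sG d0 Gdvd.
have G0 : G != 0 by rewrite -size_poly_gt0 sG.
pose H := (lead_coef G)^-1 *: G.
have lc0 : (lead_coef G)^-1 != 0 by rewrite invr_eq0 lead_coef_eq0.
have Hm : H \is monic by rewrite monicE lead_coefZ mulVf // lead_coef_eq0.
have sH : size H = d.+1 by rewrite size_scale.
have Hdvd : H %| 'X^m - c%:P by rewrite dvdpZl.
have [C HC] : exists C : 'M[F]_d, char_poly C = H.
  have : (size H).-1 = d by rewrite sH.
  case: d / {sG d0 sH} => *; by exists (companionmx H); rewrite companionmxK.
case: d d0 sG sH C HC => // d _ sG sH C HC.
have HC0 : horner_mx C H = 0 by rewrite -HC Cayley_Hamilton.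
have E : C ^+ m = c%:M.
  have /dvdpP[g Eg] := Hdvd.
  have : horner_mx C ('X^m - c%:P) = 0 by rewrite Eg rmorphM /= HC0 mulr0.
  rewrite rmorphB rmorphXn /= horner_mx_X horner_mx_C.
  by move/eqP; rewrite subr_eq0 => /eqP.
exists (\det C); rewrite -(@det_scalar F d.+1 c) -E.
elim: (m) => [|k IH]; first by rewrite !expr0 det1.
by rewrite !exprS IH det_mulmx.
Qed.

Lemma fractionE (R : idomainType) (x : {fraction R}) :
  exists a b : R, b != 0 /\ x * tofrac b = tofrac a.
Proof.
elim/quotW: x => x; exists (frac x).1, (frac x).2; split; first exact: denom_ratioP.
rewrite /GRing.mul /= !piE.
apply/eqmodP; rewrite /= FracField.equivfE /FracField.mulf !numden_Ratio ?oner_eq0 ?mulf_neq0 ?oner_eq0 ?denom_ratioP //.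
by rewrite !mulr1 mulrC.
Qed.

(* [h] is a polynomial in two variables, the outer one [X] and the inner one
   [Y]; this is its value at [Y = X^M]. *)
Definition evXM (k : fieldType) (M : nat) (h : {poly {poly k}}) : {poly k} :=
  (map_poly (comp_poly 'X^M) h).['X].

(** Uniqueness of base-[M] digits: since the outer degree is below [M], distinct monomials [X^i Y^j]
    go to distinct powers [X^(j * M + i)], so the substitution loses nothing. *)
Lemma evXM_coef (k : fieldType) (M : nat) (h : {poly {poly k}}) i j :
  (size h <= M)%N -> (i < M)%N -> (evXM M h)`_(j * M + i) = (h`_i)`_j.
Proof.
move=> sh iM; have M0 : (0 < M)%N by case: (M) iM.
rewrite /evXM (@horner_coef_wide _ M); last exact: leq_trans (size_poly _ _) sh.
rewrite coef_sum (bigD1 (Ordinal iM)) //= big1 ?addr0 => [|l li].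
  rewrite coefMXn ltnNge leq_addl /= addnK coef_map /= coef_comp_poly_Xn //.
  by rewrite dvdn_mull // mulnK.
rewrite coefMXn; case: ltnP => // lji.
rewrite coef_map /= coef_comp_poly_Xn //; case: ifP => // /dvdnP[e E].
case/eqP: li; apply: val_inj => /=; have lM := ltn_ord l.
have : (j * M + i = e * M + l)%N by lia.
by move/(congr1 (modn^~ M)); rewrite !modnMDl !modn_small.
Qed.

Lemma evXM_inj (k : fieldType) (M : nat) (h : {poly {poly k}}) :
  (size h <= M)%N -> evXM M h = 0 -> h = 0.
Proof.
move=> sh h0; apply/polyP => i; apply/polyP => j; rewrite !coef0.
have [iM|Mi] := ltnP i M; first by rewrite -(evXM_coef _ sh iM) h0 coef0.
by rewrite [h`_i]nth_default ?coef0 //; apply: leq_trans sh Mi.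
Qed.

Lemma evXM_is_zmod (k : fieldType) (M : nat) : zmod_morphism (@evXM k M).
Proof. by move=> h g; rewrite /evXM rmorphB hornerD hornerN. Qed.

Lemma evXM_is_monoid (k : fieldType) (M : nat) : monoid_morphism (@evXM k M).
Proof.
by split=> [|h g]; rewrite /evXM ?rmorph1 ?hornerC // rmorphM hornerM.
Qed.

HB.instance Definition _ (k : fieldType) (M : nat) :=
  GRing.isZmodMorphism.Build _ _ (@evXM k M) (@evXM_is_zmod k M).
HB.instance Definition _ (k : fieldType) (M : nat) :=
  GRing.isMonoidMorphism.Build _ _ (@evXM k M) (@evXM_is_monoid k M).

Lemma mup_map (F L : fieldType) (phi : {rmorphism F -> L}) (f : {poly F}) c :
  f != 0 -> mup (phi c) (map_poly phi f) = mup c f.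
Proof.
move=> f0.
have E n : (n <= mup (phi c) (map_poly phi f))%N = (n <= mup c f)%N.
  rewrite !mup_geq ?map_poly_eq0 // -(dvdp_map phi) rmorphXn /=.
  by rewrite map_polyXsubC.
by apply/eqP; rewrite eqn_leq E -E !leqnn.
Qed.

Lemma mup_exp (F : fieldType) (c : F) (f : {poly F}) n :
  f != 0 -> mup c (f ^+ n) = (n * mup c f)%N.
Proof.
move=> f0; elim: n => [|n IH]; first by rewrite mupNroot // root1.
by rewrite exprS mupM ?expf_neq0 // IH mulSn.
Qed.

(** If the resultant vanished, [f(X) Z^m - f(Y)] would have a factor of degree [d] in [Z] with
    [0 < d < m]. The product [x = a / b] of its roots satisfies [x^m = (f(Y) / f(X))^d]. Now compare
    multiplicities of the root [X = c] over the field [k(Y)], where [f(Y)] is a nonzero constant: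
    [m] divides [d * mup c f] for every [c], against the hypothesis. *)
Lemma resultant_kummer_neq0 (k : fieldType) (m : nat) (f : {poly k})
    (q : {poly {poly {poly k}}}) :
  f != 0 -> (forall d, (0 < d < m)%N -> exists c, ~~ (m %| d * mup c f)%N) ->
  q != 0 -> (size q <= m)%N ->
  resultant (map_poly polyC f *: 'X^m - f%:P%:P) q != 0.
Proof.
move=> f0 Hf q0 sq; rewrite resultant_eq0 -leqNgt leqNgt; apply/negP => sG.
set P := _ - _ in sG; set G := gcdp _ _ in sG.
have fX0 : map_poly polyC f != 0 by rewrite map_poly_eq0_id0 ?polyC_eq0 ?lead_coef_eq0.
pose fr := @tofrac {poly {poly k}}.
have fr0 x : x != 0 -> fr x != 0 by rewrite tofrac_eq0.
have GP : G %| P by apply: dvdp_gcdl.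
have Gq : G %| q by apply: dvdp_gcdr.
pose d := (size G).-1.
have dG : size G = d.+1 by rewrite /d prednK // ltnW.
have dm : (d < m)%N by rewrite -dG (leq_trans _ sq) // dvdp_leq.
pose G' := map_poly fr G.
have sG' : size G' = d.+1 by rewrite size_map_poly_id0 // fr0 // lead_coef_eq0 -size_poly_gt0 dG.
have d0 : (0 < d)%N by rewrite /d -ltnS prednK // ltnW.
have G'P : G' %| 'X^m - (fr f%:P / fr (map_poly polyC f))%:P.
  have /Pdiv.Idomain.dvdpP[[c g] /= c0 E] := GP.
  have : G' %| map_poly fr (c *: P) by rewrite E rmorphM dvdp_mull.
  rewrite map_polyZ dvdpZr ?fr0 // /P rmorphB /= map_polyZ /= map_polyXn map_polyC /=.
  suff -> : fr (map_poly polyC f) *: 'X^m - (fr f%:P)%:P =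
    fr (map_poly polyC f) *: ('X^m - (fr f%:P / fr (map_poly polyC f))%:P).
    by rewrite dvdpZr // fr0.
  rewrite scalerBr; congr (_ - _).
  by rewrite -mul_polyC -polyCM mulrC divfK // fr0.
have [x Ex] := det_root_scalar sG' d0 G'P.
have [a [b [b0 Eb]]] := fractionE x.
have E : a ^+ m * map_poly polyC f ^+ d = b ^+ m * f%:P ^+ d.
  apply/eqP; rewrite -tofrac_eq; apply/eqP.
  rewrite !tofracM !tofracXn -Eb exprMn Ex expr_div_n.
  by rewrite mulrAC divfK ?expf_neq0 ?fr0 // mulrC.
have [c] := Hf d (introT andP (conj d0 dm)); case/negP.
have m0 : (0 < m)%N by apply: leq_ltn_trans dm.
have a0 : a != 0.
  apply: contraTneq (mulf_neq0 (expf_neq0 m b0) (expf_neq0 d (_ : f%:P != 0))) => [a0|].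
    by rewrite -E a0 expr0n gtn_eqF // mul0r eqxx.
  by rewrite polyC_eq0.
pose phi : {rmorphism k -> {fraction {poly k}}} := @tofrac {poly k} \o polyC.
pose psi := map_poly (@tofrac {poly k}).
have psi0 y : y != 0 -> psi y != 0.
  by move=> y0; rewrite map_poly_eq0_id0 // tofrac_eq0 lead_coef_eq0.
have := congr1 (mup (phi c) \o psi) E.
rewrite /= /psi !rmorphM !rmorphXn /= -map_poly_comp map_polyC /=.
have phif : map_poly phi f != 0 by rewrite map_poly_eq0.
rewrite !mupM ?expf_neq0 ?psi0 // ?polyC_eq0 ?tofrac_eq0 //.
rewrite !mup_exp ?psi0 // ?polyC_eq0 ?tofrac_eq0 //.
rewrite [mup _ _%:P]mupNroot ?rootC ?tofrac_eq0 // muln0 addn0.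
rewrite [mup _ (map_poly _ f)](mup_map phi c f0) => E2.
rewrite -(dvdn_addr _ (dvdn_mulr (mup (phi c) (psi a)) (dvdnn m))) E2.
exact: dvdn_mulr.
Qed.

Lemma evXM_X (k : fieldType) (M : nat) (f : {poly k}) :
  evXM M (map_poly polyC f) = f.
Proof.
rewrite /evXM -map_poly_comp (eq_map_poly (g := polyC)) => [|c /=]; last first.
  by rewrite comp_polyC.
by rewrite -[RHS]comp_polyXr.
Qed.

Lemma evXM_Y (k : fieldType) (M : nat) (f : {poly k}) :
  evXM M f%:P = f \Po 'X^M.
Proof. by rewrite /evXM map_polyC hornerC. Qed.

Lemma evXM_Xn (k : fieldType) (M i : nat) : evXM M ('X^i : {poly {poly k}}) = 'X^i.
Proof. by rewrite -(evXM_X M 'X^i) map_polyXn. Qed.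

(* Writing [Y = X^M] and [u = f^n], one has [f(X) u^m = f(Y)], and [Y] is as
   good as transcendental over polynomials in [X] of degree well below [M]. *)
Lemma kummer_free (k : fieldType) (m n D : nat) (M := (m * n).+1)
    (f : {poly k}) (h : nat -> {poly {poly k}}) :
  f != 0 -> f ^+ M = f \Po 'X^M ->
  (forall d, (0 < d < m)%N -> exists c, ~~ (m %| d * mup c f)%N) ->
  (forall b, (size (h b) <= D.+1)%N) -> (size f <= D.+1)%N ->
  (m.*2 * D < M)%N ->
  \sum_(b < m) evXM M (h b) * f ^+ (n * b) = 0 ->
  forall b, (b < m)%N -> h b = 0.
Proof.
move=> f0 fM Hf sh sf DM Hsum.
pose q : {poly {poly {poly k}}} := \poly_(b < m) h b.
suff q0 : q = 0 by move=> b bm; have := coef_poly m h b; rewrite bm -/q q0 coef0.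
apply/eqP; apply: contraT => q0.
have sq : (size q <= m)%N := size_poly _ _.
have m0 : (0 < m)%N by rewrite (leq_trans _ sq) // size_poly_gt0.
pose P : {poly {poly {poly k}}} := map_poly polyC f *: 'X^m - f%:P%:P.
have fX0 : map_poly polyC f != 0 by rewrite map_poly_eq0_id0 ?polyC_eq0 ?lead_coef_eq0.
have sfX : size (map_poly polyC f *: 'X^m) = m.+1 by rewrite size_scale // size_polyXn.
have sP : size P = m.+1.
  by rewrite size_polyDl sfX // size_polyN (leq_ltn_trans (size_polyC_leq1 _)).
pose u := f ^+ n.
pose ev := map_poly (@evXM k M).
have evP : (ev P).[u] = 0.
  rewrite /ev /P rmorphB /= map_polyZ /= map_polyXn map_polyC /= evXM_X evXM_Y.
  by rewrite hornerD hornerN hornerZ hornerXn hornerC -fM /u -exprM mulnC -exprS subrr.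
have evq : (ev q).[u] = 0.
  rewrite (@horner_coef_wide _ m) ?(leq_trans (size_poly _ _)) // -[RHS]Hsum.
  apply: eq_bigr => b _; rewrite coef_map coef_poly ltn_ord /=.
  by rewrite /u -exprM.
have [sq1|sq1] := leqP (size q) 1.
  move: q0; rewrite [q]size1_polyC // polyC_eq0 => /eqP[]; apply: (@evXM_inj _ M).
    rewrite coef_poly m0 (leq_trans (sh _)) //.
    by rewrite (leq_trans _ DM) // ltnS leq_pmull // double_gt0.
  move: evq; rewrite [q]size1_polyC // /ev map_polyC hornerC.
  by rewrite coefC eqxx.
(* The resultant is [U * P + V * q], and both [P] and [q] vanish at [Z = u] once [Y = X^M]. Its
   degree in [X] is at most [2 m D < M], by the size of the Sylvester matrix, so [evXM_inj] makes it
   zero. *)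
have [|[U V] /= _ E] := resultant_in_ideal (_ : 1 < size P)%N sq1.
  by rewrite sP.
have := resultant_kummer_neq0 f0 Hf q0 sq; rewrite -/P => /eqP[].
apply: (@evXM_inj _ M); last first.
  have := congr1 (fun R => (ev R).[u]) E; rewrite /ev map_polyC hornerC => ->.
  by rewrite rmorphD !rmorphM hornerD !hornerM -/ev evP evq !mulr0 addr0.
rewrite /resultant; apply: (@leq_trans (((size q).-1 + (size P).-1) * D).+1).
  apply: size_det_leq => i j; rewrite Sylvester_mxE.
  have sPc (l : nat) : (size (P`_l)%R <= D.+1)%N.
    rewrite coefB coefZ coefXn coefC; apply: (leq_trans (size_polyD _ _)).
    rewrite size_polyN geq_max; apply/andP; split.
      case: (l == m); rewrite ?mulr0 ?size_poly0 // mulr1.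
      by rewrite (leq_trans (size_poly _ _)).
    by case: (l == 0%N); rewrite ?size_poly0 // (leq_trans (size_polyC_leq1 _)).
  have sqc (l : nat) : (size (q`_l)%R <= D.+1)%N.
    by rewrite coef_poly; case: ifP; rewrite ?size_poly0.
  by case: (fintype.split i) => l; case: (l <= j)%N; rewrite ?mulr0n ?mulr1n ?size_poly0.
rewrite ltnS in DM; rewrite /M ltnS (leq_trans _ DM) // leq_mul2r sP -addnn.
by rewrite leq_add ?orbT //= (leq_trans _ sq) // leq_pred.
Qed.

(** * Stepanov's method *)

Lemma expr_sum_pchar (R : comNzRingType) (M : nat) (I : Type) (r : seq I)
    (P : pred I) (F : I -> R) : [pchar R].-nat M ->
  (\sum_(i <- r | P i) F i) ^+ M = \sum_(i <- r | P i) F i ^+ M.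
Proof.
move=> HM; apply: (big_morph (fun x => x ^+ M)).
  by move=> x y; rewrite exprDn_pchar.
by rewrite expr0n; case: (M) HM.
Qed.

Lemma closed_field_root (K : closedFieldType) (M : nat) (a : K) :
  (0 < M)%N -> exists x, x ^+ M = a.
Proof.
move=> M0; have [|x] := closed_rootP ('X^M - a%:P) _.
  by rewrite size_XnsubC // eqSS -lt0n.
by rewrite /root !hornerE subr_eq0 => /eqP; exists x.
Qed.

Lemma linear_relation (K : fieldType) (T : finType) (N : nat)
    (g : T -> {poly K}) :
  (forall t, (size (g t) <= N)%N) -> (N < #|T|)%N ->
  exists2 s : T -> K, (exists t, s t != 0) & \sum_t s t *: g t = 0.
Proof.
move=> sg NT.
pose B : 'M[K]_(#|T|, N) := \matrix_i poly_rV (g (enum_val i)).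
have : kermx B != 0.
  rewrite -mxrank_eq0 mxrank_ker subn_eq0 -ltnNge.
  exact: leq_ltn_trans (rank_leq_col _) NT.
case/rowV0Pn => v /sub_kermxP vB /rV0Pn[i vi].
exists (fun t => v 0 (enum_rank t)).
  by exists (enum_val i); rewrite enum_valK.
have : rVpoly (v *m B) = 0 by rewrite vB linear0.
rewrite mulmx_sum_row linear_sum => E; rewrite -[RHS]E.
rewrite [RHS](reindex enum_rank) /=; last first.
  by exists enum_val => x _; rewrite (enum_rankK, enum_valK).
apply: eq_bigr => t _; rewrite linearZ /= rowK enum_rankK poly_rV_K //.
Qed.

(* With [u = f^n], the auxiliary polynomial is
   [A = sum S_(b,a,i) X^(i + a M) u^b].  At a point [x] of the list one has
   [x^(M^2) = x] and [u^M = c / u], so the value of [A^M u^(m-1)] there is that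
   of a polynomial of degree about [M D], linear in the [S_(b,a,i)^M]; it can
   be made zero identically.  [A] itself is not zero by [kummer_free]. *)
Lemma stepanov (K : closedFieldType) (m n D B : nat) (M := (m * n).+1)
    (f : {poly K}) (c : K) (pts : seq K) :
  [pchar K].-nat M -> f != 0 -> f ^+ M = f \Po 'X^M ->
  (forall d, (0 < d < m)%N -> exists c, ~~ (m %| d * mup c f)%N) ->
  (size f <= D.+1)%N -> (m.*2 * D < M)%N ->
  (M * D + B + M * size f < m * B * D)%N ->
  uniq pts ->
  (forall x, x \in pts ->
    [/\ x ^+ (M * M) = x, f.[x] != 0 & f.[x] ^+ (n * M.+1) = c]) ->
  (size pts <= D + B * M + M * size f)%N.
Proof.
move=> pM f0 fM Hf sf DM count upts Hpts.
have m0 : (0 < m)%N by move: count; case: (m).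
pose T := ('I_m * 'I_B * 'I_D)%type.
pose u := f ^+ n.
have su b : (b <= m)%N -> (size (u ^+ b) <= (M * (size f).-1).+1)%N.
  move=> bm; rewrite -exprM (leq_trans (size_poly_exp_leq _ _)) // ltnS mulnC leq_mul2r.
  by rewrite leqW ?orbT // mulnC leq_mul2r bm orbT.
pose g (t : T) : {poly K} :=
  c ^+ t.1.1 *: ('X^(M * t.2 + t.1.2) * u ^+ (m.-1 - t.1.1)).
have sfM : (M * (size f).-1 < M * size f)%N.
  by rewrite ltn_mul2l /= prednK ?leqnn // size_poly_gt0.
have [||sg [t0 st0] Esg] := @linear_relation K T (M * D + B + M * size f) g.
- move=> t; apply: leq_trans (size_scale_leq _ _) _.
  apply: leq_trans (size_polyMleq _ _) _; rewrite size_polyXn.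
  have : (M * t.2 <= M * D)%N by rewrite leq_mul2l (ltnW (ltn_ord t.2)) orbT.
  have /su : (m.-1 - t.1.1 <= m)%N by rewrite (leq_trans (leq_subr _ _)) // leq_pred.
  move: sfM (ltn_ord t.1.2).
  move: (size (u ^+ _)) (M * (size f).-1)%N (M * size f)%N (M * t.2)%N (M * D)%N (val t.1.2).
  by clear; lia.
- by rewrite !card_prod !card_ord.
(* The linear relation concerns the [M]-th powers of the coefficients of [A]; the coefficients
   themselves exist because [K] is algebraically closed. *)
have /fin_all_exists[S HS] t : exists x, x ^+ M = sg t by exact: closed_field_root.
pose A : {poly K} := \sum_t S t *: ('X^(t.2 + t.1.2 * M) * u ^+ t.1.1).
have sA : (size A <= D + B * M + M * size f)%N.
  apply: leq_trans (size_sum _ _ _) _; apply/bigmax_leqP => t _.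
  apply: leq_trans (size_scale_leq _ _) _.
  apply: leq_trans (size_polyMleq _ _) _; rewrite size_polyXn.
  have : (t.1.2 * M <= B * M)%N by rewrite leq_mul2r (ltnW (ltn_ord _)) orbT.
  move: (su t.1.1 (ltnW (ltn_ord _))) sfM (ltn_ord t.2).
  move: (size (u ^+ _)) (M * (size f).-1)%N (M * size f)%N (t.1.2 * M)%N (B * M)%N (val t.2).
  by clear; lia.
have A0 : A != 0.
  (* The coefficient of [u^b] in [A], read as a polynomial in [X] and [Y], with [Y] standing for
     [X^M]. *)
  pose h b := \sum_(t : T) (if t.1.1 == b :> nat then (S t *: 'X^(t.1.2))%:P * 'X^(t.2) else 0).
  apply: contra_neq st0 => A0; rewrite -HS; suff -> : S t0 = 0 by rewrite expr0n.
  have : h t0.1.1 = 0.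
    apply: (@kummer_free _ m n D f h) => // [b|].
      apply: leq_trans (size_sum _ _ _) _; apply/bigmax_leqP => t _.
      case: ifP => _; last by rewrite size_poly0.
      apply: leq_trans (size_polyMleq _ _) _; rewrite size_polyXn addnS /=.
      rewrite -[D.+1]add1n leq_add ?size_polyC_leq1 //; exact: ltnW (ltn_ord _).
    rewrite -[RHS]A0 /h; under eq_bigr => b _ do rewrite rmorph_sum mulr_suml.
    rewrite exchange_big /=; apply: eq_bigr => t _.
    rewrite (bigD1 t.1.1) //= eqxx big1 ?addr0 => [|b bt]; last first.
      by rewrite eq_sym (inj_eq val_inj) (negbTE bt) rmorph0 mul0r.
    rewrite rmorphM /= evXM_Y evXM_Xn comp_polyZ comp_Xn_poly -!exprM -!scalerAl.
    by rewrite exprD ['X^(t.2) * _]mulrC mulnC.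
  have coefh (t : T) : (if t.1.1 == t0.1.1 :> nat then (S t *: 'X^(t.1.2))%:P * 'X^(t.2)
      else 0 : {poly {poly K}})`_(t0.2)`_(t0.1.2) = if t == t0 then S t else 0.
    rewrite -!pair_eqE /= /pair_eq /= -!pair_eqE /= /pair_eq /= (inj_eq val_inj).
    case: eqP => /= _; last by rewrite !coef0.
    rewrite coefCM coefXn eq_sym (inj_eq val_inj) andbC.
    case: (t.2 == t0.2); rewrite ?mulr0 ?coef0 //= mulr1 coefZ coefXn eq_sym.
    by rewrite (inj_eq val_inj); case: eqP; rewrite ?mulr0 ?mulr1.
  move/(congr1 (fun h : {poly {poly K}} => h`_(t0.2)`_(t0.1.2))).
  rewrite !coef0 /h !coef_sum; under eq_bigr => t _ do rewrite coefh.
  by rewrite -big_mkcond big_pred1_eq.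
rewrite -ltnS; apply: leq_trans (leqW sA).
apply: max_poly_roots A0 _ upts; apply/allP => x xp.
have [xM fx0 fxc] := Hpts x xp.
have ux0 : u.[x] != 0 by rewrite horner_exp expf_neq0.
have : A.[x] ^+ M * u.[x] ^+ m.-1 = 0.
  rewrite -[RHS](horner0 x) -Esg !horner_sum expr_sum_pchar // mulr_suml.
  apply: eq_bigr => t _; rewrite /g !hornerZ !hornerM !hornerXn !horner_exp !exprMn HS.
  rewrite -!mulrA; congr (_ * _).
  have -> : x ^+ (t.2 + t.1.2 * M) ^+ M = x ^+ (M * t.2 + t.1.2).
    rewrite -exprM mulnDl -mulnA [(t.1.2 * (M * M))%N]mulnC exprD [x ^+ (M * M * _)]exprM.
    by rewrite xM -exprD [(t.2 * M)%N]mulnC.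
  rewrite [RHS]mulrCA; congr (_ * _); rewrite -fxc -!exprM -!exprD; congr (_ ^+ _).
  have bm : (t.1.1 <= m.-1)%N by rewrite -ltnS prednK.
  rewrite -[m.-1 in LHS](subnK bm); move: (m.-1 - t.1.1)%N (nat_of_ord t.1.1) (M) => e b N.
  by rewrite -[N.+1]addn1; ring.
move/eqP; rewrite mulf_eq0 !expf_eq0 (negbTE ux0) andbF orbF /=.
by rewrite /root.
Qed.

Lemma size_fixed_points (K : fieldType) (N : nat) (pts : seq K) :
  (1 < N)%N -> uniq pts -> {in pts, forall x, x ^+ N = x} -> (size pts <= N)%N.
Proof.
move=> N1 upts Hpts.
have sX : size ('X^N - 'X : {poly K}) = N.+1.
  by rewrite size_polyDl size_polyXn // size_polyN size_polyX ltnS.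
rewrite -ltnS -sX; apply: max_poly_roots upts; rewrite -?size_poly_eq0 ?sX //.
by apply/allP => x /Hpts xN; rewrite /root !hornerE xN subrr.
Qed.

(** [D] is taken as large as independence allows, about [M / (2 m)], and [B] equal to [n] plus a
    constant. The dominant term of the bound in [stepanov] is then [n * M], close to [M^2 / m], and
    everything else is linear in [M]. *)
Lemma stepanov_asymp (K : closedFieldType) (m : nat) (f : {poly K}) :
  (1 < m)%N -> f != 0 ->
  (forall d, (0 < d < m)%N -> exists c, ~~ (m %| d * mup c f)%N) ->
  exists C, forall n (M := (m * n).+1) c (pts : seq K),
  (0 < n)%N -> [pchar K].-nat M -> f ^+ M = f \Po 'X^M -> uniq pts ->
  (forall x, x \in pts ->
    [/\ x ^+ (M * M) = x, f.[x] != 0 & f.[x] ^+ (n * M.+1) = c]) ->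
  (m * size pts <= M * M + C * M)%N.
Proof.
move=> m1 f0 Hf; set sf := size f.
have sf0 : (0 < sf)%N by rewrite size_poly_gt0.
(* [C1] ensures [2 m D < M <= 2 C1 D] for [D = M %/ C1 > 0]. [K0 * D] exceeds [D + n + M * sf], by
   which [m n D] falls short in the count of unknowns, and [m >= 2] leaves another [K0 * D] to pay
   for [K0] itself. *)
pose C1 := m.*2.+1; pose K0 := (2 + 2 * C1 + 2 * C1 * sf)%N.
pose M0 := (C1 * sf)%N.
exists (m * M0 + (m + m * K0 + m * sf))%N => n M c pts n0 pM fM upts Hpts.
have M1 : (1 < M)%N by rewrite /M ltnS muln_gt0 n0 (ltnW m1).
(* Below the threshold [D] may be smaller than [sf]; there the trivial bound [M^2] is absorbed by
   the term [m * M0 * M]. *)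
have [MM0|MM0] := ltnP M M0.
  have : (size pts <= M * M)%N.
    by apply: size_fixed_points upts _ => [|x /Hpts[]//]; nia.
  rewrite -(leq_pmul2l (ltnW m1)) => /leq_trans; apply; nia.
pose D := (M %/ C1)%N.
have DC : (D * C1 <= M)%N by apply: leq_divM.
have MD : (M < D.+1 * C1)%N by apply: ltn_ceil.
have sD : (sf <= D)%N by rewrite leq_divRL // mulnC.
have D0 : (0 < D)%N by apply: leq_trans sD.
have MC : (M <= 2 * C1 * D)%N.
  have : (D.+1 * C1 <= 2 * C1 * D)%N by nia.
  lia.
have nM : (m * n)%N = M.-1 by [].
have nM' : (n <= M)%N by rewrite /M ltnW // ltnS leq_pmull // ltnW.
have DmM : (m.*2 * D < M)%N by move: DC; rewrite /C1; nia.
have count : (M * D + (n + K0) + M * sf < m * (n + K0) * D)%N.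
  have E1 : (m * (n + K0) * D + D = M * D + m * K0 * D)%N.
    by rewrite -[M]prednK ?(ltnW M1) // -nM; nia.
  have E2 : (M * sf <= 2 * C1 * sf * D)%N.
    by rewrite mulnAC leq_mul2r MC orbT.
  have E3 : (2 * K0 * D <= m * K0 * D)%N by rewrite -!mulnA leq_mul2r m1 orbT.
  have E4 : (K0 <= K0 * D)%N by rewrite leq_pmulr.
  have E5 : (K0 * D = 2 * D + 2 * C1 * D + 2 * C1 * sf * D)%N by rewrite /K0 !mulnDl.
  move: E1 E2 E3 E4 E5 MC nM' D0; rewrite -/sf -[(2 * K0 * D)%N]mulnA.
  move: (M * D)%N (M * sf)%N (m * K0 * D)%N (K0 * D)%N (2 * C1 * D)%N (2 * C1 * sf * D)%N.
  move: (m * (n + K0) * D)%N (M) (K0).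
  by clear; lia.
have := @stepanov K m n D (n + K0) f c pts pM f0 fM Hf (leqW sD) DmM count upts Hpts.
rewrite -(leq_pmul2l (ltnW m1)) => /leq_trans; apply.
rewrite -/sf -/M.
have DM : (D <= M)%N by apply: leq_trans DC; rewrite leq_pmulr.
have E1 : (m * D <= m * M)%N by rewrite leq_mul2l DM orbT.
have E2 : (m * n * M <= M * M)%N by rewrite leq_mul2r nM leq_pred orbT.
have -> : (m * (D + (n + K0) * M + M * sf) = m * D + m * n * M + (m * K0 * M + m * sf * M))%N.
  by ring.
have -> : ((m * M0 + (m + m * K0 + m * sf)) * M = m * M0 * M + m * M + (m * K0 * M + m * sf * M))%N.
  by ring.
move: E1 E2; move: (m * D)%N (m * n * M)%N (M * M)%N (m * M)%N (m * M0 * M)%N.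
by move: (m * K0 * M + m * sf * M)%N; clear; lia.
Qed.

(* The roots of [X^N - X], i.e. the field with [N] elements inside [K]
   when [N] is a power of the characteristic. *)
Definition fixf (K : closedFieldType) (N : nat) : seq K :=
  undup (sval (closed_field_poly_normal ('X^N - 'X))).

Lemma fixf_uniq (K : closedFieldType) N : uniq (fixf K N).
Proof. exact: undup_uniq. Qed.

Lemma fixfP (K : closedFieldType) N x :
  (1 < N)%N -> (x \in fixf K N) = (x ^+ N == x).
Proof.
move=> N1; rewrite mem_undup; case: closed_field_poly_normal => r /= E.
have X0 : 'X^N - 'X != 0 :> {poly K}.
  rewrite -size_poly_eq0 size_polyDl size_polyXn // size_polyN size_polyX.
  by rewrite ltnS.
rewrite -root_prod_XsubC -(rootZ _ _ (_ : lead_coef ('X^N - 'X) != 0)) ?lead_coef_eq0 //.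
by rewrite -E /root !hornerE subr_eq0.
Qed.

Lemma size_fixf (K : closedFieldType) N :
  (1 < N)%N -> [pchar K].-nat N -> size (fixf K N) = N.
Proof.
move=> N1 pN; rewrite /fixf; case: closed_field_poly_normal => r /= E.
have sX : size ('X^N - 'X : {poly K}) = N.+1.
  by rewrite size_polyDl size_polyXn // size_polyN size_polyX ltnS.
have l0 : lead_coef ('X^N - 'X : {poly K}) != 0 by rewrite lead_coef_eq0 -size_poly_eq0 sX.
have N0 : N%:R = 0 :> K.
  have pN' := pnatPpi pN (_ : pdiv N \in \pi(N)).
  by apply/eqP; rewrite -(dvdn_pcharf (pN' _)) ?pdiv_dvd // pi_pdiv.
rewrite undup_id; last first.
  rewrite -separable_prod_XsubC -(eqp_separable (eqp_scale _ l0)) -E.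
  rewrite unlock derivB derivXn derivX -mulr_natl -polyC_natr N0 mul0r sub0r.
  by rewrite -[X in coprimep _ X]scaleN1r coprimepZr ?oppr_eq0 ?oner_eq0 // coprimep1.
have := congr1 (fun g : {poly K} => size g) E.
by rewrite /= sX size_scale // size_prod_XsubC => -[].
Qed.

(* An upper bound [U] on each class suffices, because the sizes of the classes
   add up to a known number. *)
Lemma sum_class_bound (T : eqType) (I : eqType) (pts : seq I) (mu : seq T)
    (g : I -> T) (theta : T -> algC) (U : algC) (e : algC) :
  uniq mu -> {in pts, forall x, g x \in mu} ->
  {in mu, forall c, `|theta c| <= 1} ->
  {in mu, forall c, (count (fun x => g x == c) pts)%:R <= U} ->
  \sum_(c <- mu) theta c = 0 -> (size mu)%:R * U - (size pts)%:R <= e ->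
  `|\sum_(x <- pts) theta (g x)| <= e.
Proof.
move=> umu gmu th1 cU th0; apply: le_trans.
pose N c := count (fun x => g x == c) pts.
have split (F : T -> algC) : \sum_(x <- pts) F (g x) = \sum_(c <- mu) F c *+ N c.
  have -> : \sum_(x <- pts) F (g x) =
      \sum_(x <- pts) \sum_(c <- mu) (if g x == c then F c else 0).
    rewrite !big_seq; apply: eq_bigr => x /gmu gx.
    rewrite (bigD1_seq (g x)) //= eqxx big1 ?addr0 // => c.
    by rewrite eq_sym => /negbTE ->.
  rewrite exchange_big /=; apply: eq_bigr => c _.
  by rewrite -big_mkcond big_const_seq iter_addr_0.
(* Since the [theta c] add up to zero, each count may be replaced by its deficit from [U]; the
   deficits are nonnegative and their total is at most [e]. *)
have -> : \sum_(x <- pts) theta (g x) = - \sum_(c <- mu) theta c * (U - (N c)%:R).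
  under [in RHS]eq_bigr => c _ do rewrite mulrBr mulr_natr.
  by rewrite sumrB -mulr_suml th0 mul0r sub0r opprK split.
rewrite normrN (le_trans (ler_norm_sum _ _ _)) //.
apply: (@le_trans _ _ (\sum_(c <- mu) (U - (N c)%:R))).
  rewrite !big_seq; apply: ler_sum => c cmu; rewrite normrM.
  have Uc : 0 <= U - (N c)%:R by rewrite subr_ge0 cU.
  by rewrite (ger0_norm Uc) ler_piMl // th1.
rewrite sumrB big_const_seq iter_addr_0 count_predT mulr_natl lerD2l lerN2.
have := split (fun=> 1); rewrite big_const_seq iter_addr_0 count_predT => ->.
by rewrite lexx.
Qed.

(** As [m n (M + 1) = M^2 - 1], the value [f(x)^(n (M + 1))] is an [m]-th root of unity. Each of the
    [m] classes has at most [(M^2 + C M) / m] points, while together they miss at most [e] of the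
    [M^2] elements. *)
Lemma kummer_sum_bound (K : closedFieldType) (m : nat) (f : {poly K})
    (mu : seq K) (theta : K -> algC) :
  (1 < m)%N -> f != 0 ->
  (forall d, (0 < d < m)%N -> exists c, ~~ (m %| d * mup c f)%N) ->
  uniq mu -> size mu = m -> (forall c, (c \in mu) = (c ^+ m == 1)) ->
  {in mu, forall c, `|theta c| <= 1} -> \sum_(c <- mu) theta c = 0 ->
  exists C : nat, forall n (M := (m * n).+1) e (pts : seq K),
  (0 < n)%N -> [pchar K].-nat M -> f ^+ M = f \Po 'X^M ->
  uniq pts -> {in pts, forall x, x ^+ (M * M) = x /\ f.[x] != 0} ->
  (M * M <= size pts + e)%N ->
  `|\sum_(x <- pts) theta (f.[x] ^+ (n * M.+1))| <= (C * M + e)%:R.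
Proof.
move=> m1 f0 Hf umu smu muP th1 th0.
have [C HC] := stepanov_asymp m1 f0 Hf.
exists C => n M e pts n0 pM fM upts ptsP spts.
have m0C : m%:R != 0 :> algC by rewrite pnatr_eq0 -lt0n ltnW.
pose U : algC := (M * M + C * M)%:R / m%:R.
apply: (@sum_class_bound _ _ pts mu (fun x => f.[x] ^+ (n * M.+1)) theta U) => //.
- move=> x /ptsP[xM fx0]; rewrite muP -exprM.
  have fxM : f.[x] ^+ M ^+ M = f.[x].
    have fM' y : f.[y] ^+ M = f.[y ^+ M].
      by rewrite -horner_exp fM horner_comp hornerXn.
    by rewrite !fM' -exprM xM.
  apply/eqP; apply: (mulfI fx0); rewrite mulr1 -exprS -[RHS]fxM -exprM; congr (_ ^+ _).
  by rewrite /M; ring.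
- move=> c cmu; rewrite ler_pdivlMr ?ltr0n ?(ltnW m1) // -natrM ler_nat mulnC.
  rewrite -size_filter; apply: (HC n c) => //; first exact: filter_uniq.
  by move=> x; rewrite mem_filter => /andP[/eqP fc /ptsP[]].
rewrite smu mulrC divfK // lerBlDr -natrD ler_nat.
by rewrite addnC -addnA leq_add2l addnC.
Qed.

(** * Power sums *)

Definition recip_poly (R : comNzRingType) (s : seq R) : {poly R} :=
  \prod_(w <- s) (1 - w *: 'X).

(** Newton's identities, i.e. the coefficients of [X E' = - (sum_(r >= 1) p_r X^r) E], where [E] is
    [recip_poly s] and [p_r] the [r]-th power sum; the induction adds one factor [1 - w X]. *)
Lemma recip_poly_newton (R : comNzRingType) (s : seq R) n :
  n%:R * (recip_poly s)`_n =
  - \sum_(i < n) (\sum_(w <- s) w ^+ i.+1) * (recip_poly s)`_(n - i.+1).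
Proof.
elim: s n => [|w s IH] n.
  rewrite /recip_poly big_nil big1 ?oppr0 => [|i _]; last by rewrite big_nil mul0r.
  by rewrite coef1; case: n => [|n] /=; rewrite ?mulr0n ?mul0r ?mulr0.
case: n => [|n]; first by rewrite big_ord0 oppr0 mul0r.
set E := recip_poly s in IH *.
have EE : recip_poly (w :: s) = E - w *: (E * 'X).
  by rewrite /recip_poly big_cons -/(recip_poly s) -/E mulrBl mul1r -scalerAl mulrC.
have E0 j : (recip_poly (w :: s))`_j = E`_j - w * (if j == 0%N then 0 else E`_j.-1).
  by rewrite EE coefB coefZ coefMX.
have IH1 := IH n.+1; have IH0 := IH n.
have -> : \sum_(i < n.+1) (\sum_(v <- w :: s) v ^+ i.+1) * (recip_poly (w :: s))`_(n.+1 - i.+1)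
  = \sum_(i < n.+1) (\sum_(v <- s) v ^+ i.+1) * E`_(n.+1 - i.+1)
    - w * \sum_(i < n) (\sum_(v <- s) v ^+ i.+1) * E`_(n - i.+1) + w * E`_n.
  have -> : w * E`_n = \sum_(i < n.+1) w ^+ i.+1 * E`_(n - i) - \sum_(i < n) w ^+ i.+2 * E`_(n - i.+1).
    by rewrite big_ord_recl /= subn0 expr1 addrK.
  have -> : \sum_(i < n) w ^+ i.+2 * E`_(n - i.+1) =
      \sum_(i < n.+1) w ^+ i.+2 * (if (n - i)%N == 0%N then 0 else E`_(n - i).-1).
    rewrite big_ord_recr /= subnn eqxx mulr0 addr0; apply: eq_bigr => i _.
    by rewrite subn_eq0 leqNgt ltn_ord /= subnS.
  have -> : w * \sum_(i < n) (\sum_(v <- s) v ^+ i.+1) * E`_(n - i.+1) =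
      \sum_(i < n.+1) w * ((\sum_(v <- s) v ^+ i.+1) * (if (n - i)%N == 0%N then 0 else E`_(n - i).-1)).
    rewrite big_ord_recr /= subnn eqxx !mulr0 addr0 mulr_sumr; apply: eq_bigr => i _.
    by rewrite subn_eq0 leqNgt ltn_ord /= subnS.
  rewrite -!sumrB -big_split /=; apply: eq_bigr => i _.
  rewrite E0 subSS big_cons [w ^+ i.+2]exprS.
  by move: (\sum_(v <- s) _) (E`_(n - i)) (if _ then _ else _) (w ^+ i.+1) => a b c d; ring.
rewrite opprD opprB -[- (\sum_(i < n.+1) _)]opprK.
have -> : \sum_(i < n.+1) (\sum_(v <- s) v ^+ i.+1) * E`_(n.+1 - i.+1) = - (n.+1%:R * E`_n.+1).
  by rewrite IH1 opprK.
have -> : \sum_(i < n) (\sum_(v <- s) v ^+ i.+1) * E`_(n - i.+1) = - (n%:R * E`_n).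
  by rewrite IH0 opprK.
rewrite E0 /=; ring.
Qed.

(** With [A 0 = 1] the recursion determines [T] from [A]. The inverse roots of the polynomial with
    coefficients [A] have power sums satisfying the same recursion up to sign. *)
Lemma power_sum_of_newton (A T : nat -> algC) N :
  A 0%N = 1 -> (forall n, (N < n)%N -> A n = 0) ->
  (forall n, n%:R * A n = \sum_(1 <= r < n.+1) T r * A (n - r)%N) ->
  exists2 s : seq algC, (size s <= N)%N &
    forall r, (0 < r)%N -> T r = - \sum_(w <- s) w ^+ r.
Proof.
move=> A0 AN newt; pose L := \poly_(i < N.+1) A i.
have LE i : L`_i = A i.
  by rewrite coef_poly ltnS; case: leqP => // /AN.
have [r Er] := closed_field_poly_normal L.
have L0 : L.[0] = 1 by rewrite horner_coef0 LE.
have Ln0 : L != 0 by apply: contraTneq (oner_neq0 algC) => L00; rewrite -L0 L00 horner0 eqxx.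
have r0 z : z \in r -> z != 0.
  apply: contraTneq => ->; rewrite -root_prod_XsubC; apply/negP => rt.
  move: (oner_neq0 algC); rewrite -L0 Er hornerZ (eqP rt) mulr0 eqxx //.
pose s := [seq z^-1 | z <- r].
have LE2 : L = recip_poly s.
  have E : \prod_(z <- r) ('X - z%:P) = (\prod_(z <- r) (- z)) *: recip_poly s.
    rewrite /recip_poly big_map -mul_polyC rmorph_prod -big_split /= !big_seq.
    apply: eq_bigr => z /r0 z0; rewrite mulrBr mulr1 -mul_polyC mulrA -polyCM mulNr mulfV //.
    by rewrite polyCN polyCN mulN1r opprK addrC.
  have [c Lc] : exists c, L = c *: recip_poly s by eexists; rewrite {1}Er E scalerA.
  have : L.[0] = c.
    rewrite Lc hornerZ /recip_poly horner_prod big1 ?mulr1 // => w _.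
    by rewrite !hornerE subr0.
  by rewrite L0 => c1; rewrite Lc -c1 scale1r.
exists s.
  rewrite size_map -ltnS -(size_prod_XsubC r id).
  rewrite -(size_scale _ (_ : lead_coef L != 0)) ?lead_coef_eq0 // -Er.
  exact: size_poly.
elim/ltn_ind => n IH n0; case: n n0 IH => // n _ IH.
have := newt n.+1; rewrite big_nat_recr //= subnn A0 mulr1.
have := recip_poly_newton s n.+1; rewrite -LE2 LE => ->.
rewrite big_ord_recr /= subnn LE A0 mulr1 opprD.
rewrite big_add1 big_mkord /= -sumrN => E.
apply/esym; move: E; rewrite (eq_bigr (fun i : 'I_n => T i.+1 * A (n.+1 - i.+1)%N)).
  by move/addrI.
by move=> i _; rewrite LE IH // ?mulNr // ltnS.
Qed.

Lemma bernoulli_ineq (F : numDomainType) (y : F) t :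
  0 <= y -> 1 + y *+ t <= (1 + y) ^+ t.
Proof.
move=> y0; elim: t => [|t IH]; first by rewrite mulr0n addr0.
have y1 : 0 <= 1 + y by rewrite addr_ge0.
rewrite exprS; apply: le_trans (ler_wpM2l y1 IH).
rewrite mulrDl mul1r mulrDr mulr1 mulrS [y + _]addrC addrA lerD2l.
by rewrite lerDl mulr_ge0 // mulrn_wge0.
Qed.

Lemma bounded_powers_le1 (x D : algC) :
  0 <= x -> (forall t, (0 < t)%N -> x ^+ t <= D) -> x <= 1.
Proof.
move=> x0 HD; rewrite real_leNgt ?ger0_real //; apply/negP => x1.
have xm : 0 < x - 1 by rewrite subr_gt0.
have D0 : 0 <= D by apply: le_trans x0 _; have := HD 1%N isT; rewrite expr1.
have h : 0 <= D / (x - 1) by rewrite divr_ge0 // ltW.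
have := archi_boundP h; move: (Num.bound _) => t; rewrite ltr_pdivrMr // mulr_natl => Dt.
case: t Dt => [|t] Dt; first by have := le_lt_trans D0 Dt; rewrite mulr0n ltxx.
have := bernoulli_ineq t.+1 (ltW xm); rewrite [X in X ^+ _]addrC subrK => B.
have := le_lt_trans (le_trans B (HD t.+1 isT)) Dt.
by rewrite gtrDr ltr10.
Qed.

Lemma sum_coef_horner (R : comNzRingType) (h : {poly R}) (y : R) t :
  \sum_(j < size h) y ^+ (t + j) * h`_j = y ^+ t * h.[y].
Proof.
rewrite horner_coef mulr_sumr; apply: eq_bigr => j _.
by rewrite exprD -mulrA [h`_j * _]mulrC.
Qed.

(* A polynomial [h] vanishing on [s] except at [v] isolates [v^t] as a fixed
   linear combination of consecutive power sums. *)
Lemma power_sum_eigenvalue_bound (s : seq algC) (B C : algC) :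
  0 < B -> (forall t, (0 < t)%N -> `|\sum_(v <- s) v ^+ t| <= C * B ^+ t) ->
  {in s, forall v, `|v| <= B}.
Proof.
move=> B0 HS v vs.
pose h : {poly algC} := \prod_(y <- rem v (undup s)) ('X - y%:P).
have hv : h.[v] != 0.
  by rewrite -[_ == 0]/(root h v) root_prod_XsubC mem_rem_uniq ?undup_uniq // inE eqxx.
have hy y : y \in s -> y != v -> h.[y] = 0.
  move=> ys yv; apply/eqP; rewrite -[_ == 0]/(root h y) root_prod_XsubC.
  by rewrite mem_rem_uniq ?undup_uniq // inE yv mem_undup.
have E t : \sum_(y <- s) \sum_(j < size h) y ^+ (t + j) * h`_j =
    (v ^+ t * h.[v]) *+ count_mem v s.
  rewrite -iter_addr_0 -big_const_seq [RHS]big_mkcond /= !big_seq.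
  apply: eq_bigr => y ys; rewrite sum_coef_horner.
  by case: (eqVneq y v) => [->//|yv]; rewrite hy ?mulr0.
pose D := (\sum_(j < size h) `|h`_j| * (C * B ^+ j)) / `|h.[v]|.
have nv0 : 0 < `|h.[v]| by rewrite normr_gt0.
have vD t : (0 < t)%N -> (`|v| / B) ^+ t <= D.
  move=> t0; rewrite expr_div_n ler_pdivrMr ?exprn_gt0 // /D mulrAC ler_pdivlMr //.
  rewrite -normrX -normrM.
  apply: (@le_trans _ _ (`|(v ^+ t * h.[v]) *+ count_mem v s|)).
    by rewrite normrMn -[X in X <= _]mulr1n ler_wpMn2l // -has_count has_pred1.
  rewrite -E exchange_big (le_trans (ler_norm_sum _ _ _)) // mulr_suml; apply: ler_sum => j _.
  rewrite -mulr_suml normrM mulrC -mulrA ler_wpM2l // -mulrA -exprD [(j + t)%N]addnC.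
  by rewrite HS // addn_gt0 t0.
rewrite -[B]mul1r -ler_pdivrMr //.
apply: (bounded_powers_le1 _ vD); by rewrite divr_ge0 // ltW.
Qed.

(** * The L-function of a multiplicative function on monic polynomials *)

(** Carrying the proof as an argument lets the power map be a ring morphism by instance
    inference. *)
Definition frobN (K : comNzRingType) (N : nat) of [pchar K].-nat N := fun x : K => x ^+ N.

Lemma frobN_is_zmod (K : comNzRingType) N (pN : [pchar K].-nat N) :
  zmod_morphism (frobN pN).
Proof.
move=> x y; rewrite /frobN exprDn_pchar //; congr (_ + _); apply/eqP.
rewrite -addr_eq0 addrC -exprDn_pchar // addrN.
by rewrite expr0n; case: (N) pN.
Qed.

Lemma frobN_is_monoid (K : comNzRingType) N (pN : [pchar K].-nat N) :
  monoid_morphism (frobN pN).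
Proof. by split=> [|x y]; rewrite /frobN ?expr1n ?exprMn. Qed.

Lemma frobNE (K : comNzRingType) N (pN : [pchar K].-nat N) x : frobN pN x = x ^+ N.
Proof. by []. Qed.

HB.instance Definition _ (K : comNzRingType) N (pN : [pchar K].-nat N) :=
  GRing.isZmodMorphism.Build _ _ (frobN pN) (frobN_is_zmod pN).
HB.instance Definition _ (K : comNzRingType) N (pN : [pchar K].-nat N) :=
  GRing.isMonoidMorphism.Build _ _ (frobN pN) (frobN_is_monoid pN).

(** Monic polynomials of degree [n] are indexed by their lower coefficients, so that sums over them
    range over a finite type. *)
Definition mon (F : fieldType) (n : nat) (v : 'rV[F]_n) : {poly F} :=
  'X^n + rVpoly v.

Definition unmon (F : fieldType) (n : nat) (f : {poly F}) : 'rV[F]_n :=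
  poly_rV (f - 'X^n).

Lemma mon_size (F : fieldType) n (v : 'rV[F]_n) : size (mon v) = n.+1.
Proof. by rewrite size_polyDl size_polyXn // ltnS size_poly. Qed.

Lemma mon_monic (F : fieldType) n (v : 'rV[F]_n) : mon v \is monic.
Proof.
by rewrite monicE lead_coefDl ?lead_coefXn // size_polyXn ltnS size_poly.
Qed.

Lemma monK (F : fieldType) n : cancel (@mon F n) (@unmon F n).
Proof. by move=> v; rewrite /unmon /mon addrC addKr rVpolyK. Qed.

Lemma unmonK (F : fieldType) n (f : {poly F}) :
  f \is monic -> size f = n.+1 -> mon (unmon n f) = f.
Proof.
move=> fm sf; rewrite /mon poly_rV_K; first by rewrite addrC subrK.
apply/leq_sizeP => i; rewrite leq_eqVlt => /orP[/eqP <-|ni].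
  by rewrite coefB coefXn eqxx -[n]/(n.+1.-1) -sf -lead_coefE (monicP fm) subrr.
by rewrite coefB coefXn gtn_eqF // subr0 nth_default // sf.
Qed.

Lemma prod_XsubC_exp_dvdp (F : fieldType) (s : seq F) (f : {poly F}) e :
  f != 0 -> uniq s -> {in s, forall x, (e <= mup x f)%N} ->
  (\prod_(x <- s) ('X - x%:P)) ^+ e %| f.
Proof.
move=> f0; elim: s => [|x s IH] /=; first by rewrite big_nil expr1n dvd1p.
case/andP=> xs us Hs; rewrite big_cons exprMn Gauss_dvdp.
  rewrite -mup_geq // Hs ?mem_head // IH // => y ys.
  by rewrite Hs // inE ys orbT.
rewrite coprimep_expl // coprimep_expr // coprimep_sym coprimep_XsubC.
by rewrite root_prod_XsubC.
Qed.

Lemma sum_dvdn_leq (d e n : nat) : (0 < d)%N -> (d * e <= n)%N ->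
  (\sum_(1 <= r < n.+1) ((d %| r) && (r <= d * e)) = e)%N.
Proof.
move=> d0 den; rewrite (@big_cat_nat _ _ _ (d * e).+1) //=.
rewrite [X in (_ + X)%N]big_nat_cond [X in (_ + X)%N]big1 ?addn0 => [|r]; last first.
  by rewrite andbT => /andP[h _]; rewrite leqNgt h andbF.
rewrite -[RHS](mulKn e d0) divn_count_dvd !big_nat; apply: eq_bigr => r.
by rewrite ltnS => /andP[_ ->]; rewrite andbT.
Qed.

(** * Frobenius orbits and Newton's identities for the L-function *)

Section Newton.

Variables (Fq : finFieldType) (K : closedFieldType) (emb : {rmorphism Fq -> K}).
Variables (p k : nat).
Hypotheses (p_prime : prime p) (k_gt0 : (0 < k)%N) (card_Fq : #|Fq| = (p ^ k)%N).
Local Notation q := (p ^ k)%N.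

Lemma q_gt1 : (1 < q)%N.
Proof. by rewrite -card_Fq finNzRing_gt1. Qed.

Lemma pchar_closure : p \in [pchar K].
Proof. by rewrite (fmorph_pchar emb) (card_finPcharP card_Fq). Qed.

Lemma pnat_q r : [pchar K].-nat (q ^ r)%N.
Proof.
rewrite !pnatX; apply/orP; left; apply/orP; left.
by rewrite pnatE // pchar_closure.
Qed.

Lemma qX_gt1 r : (0 < r)%N -> (1 < q ^ r)%N.
Proof. by move=> r0; rewrite -(exp1n r) ltn_exp2r // q_gt1. Qed.

Lemma fixed_emb x : x ^+ q = x -> exists y, x = emb y.
Proof.
move=> xq; have ui : uniq (map emb (enum Fq)).
  by rewrite map_inj_uniq ?enum_uniq //; apply: fmorph_inj.
have xf : x \in fixf K q by rewrite fixfP ?q_gt1 // xq.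
have [] := uniq_min_size ui (_ : {subset _ <= fixf K q}).
- move=> _ /mapP[y _ ->]; rewrite fixfP ?q_gt1 // -rmorphXn -card_Fq expf_card.
  exact: eqxx.
- rewrite size_fixf ?q_gt1 //; last by rewrite -[q]expn1 pnat_q.
  by rewrite size_map -cardE card_Fq.
by move=> _ E; move: xf; rewrite -E => /mapP[y _ ->]; exists y.
Qed.

Lemma frob_emb r (f : {poly Fq}) :
  map_poly (frobN (pnat_q r)) (map_poly emb f) = map_poly emb f.
Proof.
rewrite -map_poly_comp; apply: eq_map_poly => c /=; rewrite /frobN -rmorphXn.
congr (emb _); elim: r => [|r IH]; first by rewrite expn0 expr1.
by rewrite expnS exprM -card_Fq expf_card card_Fq.
Qed.

(* The characteristic polynomial over [F_q] of [x] in [F_(q^r)]. *)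
Definition nrm r (x : K) : {poly K} := \prod_(i < r) ('X - (x ^+ (q ^ i))%:P).

(** Frobenius permutes the factors of [nrm r x] cyclically, so the coefficients are fixed by it and
    come from [F_q]. *)
Lemma nrm_emb r x : x ^+ (q ^ r) = x ->
  exists2 g : {poly Fq}, g \is monic & size g = r.+1 /\ map_poly emb g = nrm r x.
Proof.
move=> xr; have fixn : map_poly (frobN (pnat_q 1)) (nrm r x) = nrm r x.
  rewrite rmorph_prod /=; case: r xr => [|r] xr; first by rewrite /nrm !big_ord0.
  rewrite /nrm big_ord_recr big_ord_recl /= mulrC map_polyXsubC /= frobNE.
  rewrite -exprM -expnD addn1 xr expn0 expr1; congr (_ * _).
  by apply: eq_bigr => i _; rewrite map_polyXsubC /= frobNE -exprM -expnD addn1.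
have sn : size (nrm r x) = r.+1.
  by rewrite /nrm -(big_mkord xpredT (fun i => 'X - (x ^+ (q ^ i))%:P)) size_prod_XsubC size_iota subn0.
have nm : nrm r x \is monic by apply: monic_prod_XsubC.
have /fin_all_exists[y Hy] (i : 'I_r.+1) : exists y, (nrm r x)`_i = emb y.
  apply: fixed_emb; have := congr1 (fun f : {poly K} => f`_i) fixn.
  by rewrite coef_map /= /frobN expn1.
pose g := \poly_(i < r.+1) y (inord i).
have gE : map_poly emb g = nrm r x.
  apply/polyP => i; rewrite coef_map coef_poly /=; case: ltnP => ir.
    by rewrite -Hy inordK.
  by rewrite rmorph0 nth_default // sn.
exists g; last by rewrite -(size_map_poly emb) gE.
by rewrite -(map_monic emb) gE.
Qed.

Lemma mup_conj (f : {poly Fq}) x i : f != 0 ->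
  mup (x ^+ (q ^ i)) (map_poly emb f) = mup x (map_poly emb f).
Proof.
move=> f0; rewrite -(frobNE (pnat_q i)) -{1}(frob_emb i f).
by rewrite mup_map // map_poly_eq0.
Qed.

Lemma root_conj (f : {poly Fq}) x i :
  root (map_poly emb f) (x ^+ (q ^ i)) = root (map_poly emb f) x.
Proof. by rewrite -(frobNE (pnat_q i)) -{1}(frob_emb i f) fmorph_root. Qed.

Lemma frob_exp_inj r : injective (fun x : K => x ^+ (q ^ r)).
Proof. exact: (@fmorph_inj _ _ (frobN (pnat_q r))). Qed.

Lemma frob_expD (x : K) i j : x ^+ (q ^ (i + j)) = x ^+ (q ^ i) ^+ (q ^ j).
Proof. by rewrite expnD exprM. Qed.

Lemma conj_eq (x : K) i j : (i <= j)%N ->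
  (x ^+ (q ^ i) == x ^+ (q ^ j)) = (x ^+ (q ^ (j - i)) == x).
Proof.
move=> ij; rewrite -{1}(subnK ij) frob_expD eq_sym.
exact: (inj_eq (@frob_exp_inj i)).
Qed.

(** All conjugates of [x] are roots of [f], so two of the first [size f] coincide, and injectivity
    of Frobenius moves the coincidence back to [x]; [d] is the least period. *)
Lemma conj_period (f : {poly Fq}) x : f != 0 -> root (map_poly emb f) x ->
  exists d, [/\ (0 < d)%N, forall r, (x ^+ (q ^ r) == x) = (d %| r)%N &
    uniq [seq x ^+ (q ^ i) | i <- iota 0 d]].
Proof.
move=> f0 fx; pose P d := (0 < d)%N && (x ^+ (q ^ d) == x).
have exP : exists d, P d.
  pose s := [seq x ^+ (q ^ i) | i <- iota 0 (size f)].
  have : ~~ uniq s.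
    apply/negP => us; have := max_poly_roots (_ : map_poly emb f != 0) _ us.
    rewrite map_poly_eq0 size_map_poly size_map size_iota ltnn => h.
    suff: false by []; apply: h => //; apply/allP => _ /mapP[i _ ->].
    by rewrite root_conj.
  case/(uniqPn 0) => i [j [ij]]; rewrite size_map size_iota => js.
  rewrite !(nth_map 0%N) ?size_iota ?(ltn_trans ij) // !nth_iota ?(ltn_trans ij) // !add0n.
  move/eqP; rewrite conj_eq ?(ltnW ij) // => xji.
  by exists (j - i)%N; rewrite /P subn_gt0 ij.
case: (ex_minnP exP) => d /andP[d0 /eqP xd] dmin.
have xdm e : x ^+ (q ^ (e * d)) = x.
  by elim: e => [|e IH]; rewrite ?mul0n ?expr1 // mulSnr frob_expD IH.
have per r : (x ^+ (q ^ r) == x) = (d %| r)%N.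
  rewrite {1}(divn_eq r d) frob_expD xdm; apply/idP/idP => [xr|].
    rewrite /dvdn; apply: contraT; rewrite -lt0n => r0.
    by have := dmin (r %% d)%N; rewrite /P r0 xr leqNgt ltn_pmod // => /(_ isT).
  by rewrite /dvdn => /eqP ->; rewrite expr1.
exists d; split=> //; rewrite map_inj_in_uniq ?iota_uniq // => i j.
rewrite !mem_iota !add0n /=.
wlog ij : i j / (i <= j)%N.
  by move=> W id jd E; case: (leqP i j) => [/W|/ltnW/W]; move/(_ _ _ _)=> H; [apply: H|apply/esym/H].
move=> _ jd /eqP; rewrite conj_eq // per => dji.
apply/eqP; rewrite eqn_leq ij -subn_eq0; apply: contraT; rewrite -lt0n => ji0.
by have := dvdn_leq ji0 dji; rewrite leqNgt (leq_ltn_trans (leq_subr _ _)).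
Qed.

(** Let [pi] be the product over the orbit of a root [x], of length [d]. Only [r = j d] counts, and
    [nrm r x] is then [pi^j], which divides [f] exactly when [j] is at most the multiplicity of [x],
    conjugates having equal multiplicities. *)
Lemma sum_nrm_dvdp (f : {poly Fq}) n x : f != 0 -> (size f <= n.+1)%N ->
  (\sum_(1 <= r < n.+1)
    ((x ^+ (q ^ r) == x) && (nrm r x %| map_poly emb f)%R) =
   mup x (map_poly emb f))%N.
Proof.
move=> f0 sf; set g := map_poly emb f.
have g0 : g != 0 by rewrite map_poly_eq0.
have [fx|fx] := boolP (root g x); last first.
  rewrite mupNroot // big_nat big1 // => r /andP[r0 _].
  apply/eqP; rewrite eqb0; apply: contra fx => /andP[_ /dvdpP[h ->]].
  case: r r0 => // r _; rewrite /nrm big_ord_recl /= expr1 rootM rootM.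
  by rewrite root_XsubC eqxx orbT.
have [d [d0 per ud]] := conj_period f0 fx.
set e := mup x g; pose pi := \prod_(z <- [seq x ^+ (q ^ i) | i <- iota 0 d]) ('X - z%:P).
have piE : pi = nrm d x.
  by rewrite /pi /nrm big_map -(big_mkord xpredT (fun i => 'X - (x ^+ (q ^ i))%:P)) /index_iota subn0.
have nrmE j : nrm (j * d) x = pi ^+ j.
  elim: j => [|j IH]; first by rewrite /nrm mul0n big_ord0.
  rewrite mulSnr exprSr -IH piE /nrm big_split_ord; congr (_ * _).
  apply: eq_bigr => i _ /=; rewrite frob_expD.
  by have /eqP -> : x ^+ (q ^ (j * d)) == x by rewrite per dvdn_mull.
have pij j : (pi ^+ j %| g) = (j <= e)%N.
  apply/idP/idP => [|je].
    rewrite /e mup_geq //; apply: dvdp_trans; apply: dvdp_exp2r.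
    rewrite dvdp_XsubCl root_prod_XsubC; apply/mapP; exists 0%N; last by rewrite expr1.
    by rewrite mem_iota.
  apply: prod_XsubC_exp_dvdp => // _ /mapP[i _ ->].
  by rewrite mup_conj.
rewrite -[RHS](@sum_dvdn_leq d e n) //.
  apply: eq_big_nat => r _; rewrite per.
  case: (boolP (d %| r)%N) => //= /dvdnP[j ->].
  by rewrite nrmE pij mulnC leq_pmul2l.
have := dvdp_leq g0 (_ : pi ^+ e %| g); rewrite pij leqnn => /(_ isT).
rewrite -nrmE /nrm -(big_mkord xpredT (fun i => 'X - (x ^+ (q ^ i))%:P)).
rewrite size_prod_XsubC size_iota subn0 size_map_poly => h.
by rewrite -ltnS mulnC (leq_trans h).
Qed.

Lemma sum_count_undup (T : eqType) (s : seq T) :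
  (\sum_(x <- undup s) count_mem x s = size s)%N.
Proof.
have E x : count_mem x s = (\sum_(y <- s) (y == x))%N.
  by elim: s => [|y s IH]; rewrite ?big_nil // big_cons /= IH.
under eq_bigr => x _ do rewrite E.
rewrite exchange_big /= -sum1_size !big_seq; apply: eq_bigr => y ys.
rewrite (bigD1_seq y) ?mem_undup ?undup_uniq //= eqxx big1 // => x.
by rewrite eq_sym => /negbTE ->.
Qed.

Lemma sum_nat_bool (T : Type) (s : seq T) (b : pred T) :
  (\sum_(x <- s) b x = size [seq x <- s | b x])%N.
Proof. by elim: s => [|y s IH]; rewrite ?big_nil // big_cons /= IH; case: ifP. Qed.

(** Only roots of [f] contribute, each with its multiplicity by [sum_nrm_dvdp], and the
    multiplicities add up to the degree. *)
Lemma sum_nrm_monic (f : {poly Fq}) n : f \is monic -> size f = n.+1 ->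
  (\sum_(1 <= r < n.+1) \sum_(x <- fixf K (q ^ r)) (nrm r x %| map_poly emb f)%R = n)%N.
Proof.
move=> fm sf; have f0 := monic_neq0 fm.
have [s Es] := closed_field_poly_normal (map_poly emb f).
rewrite (monicP _) ?map_monic // scale1r in Es.
have ss : size s = n.
  by have := congr1 (fun g : {poly K} => size g) Es; rewrite /= size_map_poly sf size_prod_XsubC => -[].
have E r : (0 < r)%N -> (\sum_(x <- fixf K (q ^ r)) (nrm r x %| map_poly emb f)%R =
   \sum_(x <- undup s) ((x ^+ (q ^ r) == x) && (nrm r x %| map_poly emb f)%R))%N.
  move=> r0; rewrite !sum_nat_bool; apply/perm_size/uniq_perm.
  - by rewrite filter_uniq ?fixf_uniq.
  - by rewrite filter_uniq ?undup_uniq.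
  move=> x; rewrite !mem_filter fixfP ?qX_gt1 // mem_undup andbC.
  case: eqP => //= _; have [/dvdpP[h E]|//] := boolP (_ %| _).
  rewrite -root_prod_XsubC -Es E.
  by case: r r0 E => // r _ _; rewrite /nrm big_ord_recl /= expr1 !rootM root_XsubC eqxx orbT.
under eq_big_nat => r /andP[r0 _] do rewrite E //.
rewrite exchange_big /= -[RHS]ss -sum_count_undup; apply: eq_bigr => x _.
by rewrite sum_nrm_dvdp ?sf // Es mu_prod_XsubC.
Qed.

(* Inverse of [map_poly emb] on its image; a junk value elsewhere. *)
Definition descend (g : {poly K}) : {poly Fq} :=
  \poly_(i < size g) odflt 0 [pick y | emb y == g`_i].

Lemma descendK f : descend (map_poly emb f) = f.
Proof.
apply/polyP => i; rewrite /descend coef_poly size_map_poly; case: ltnP => fi.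
  rewrite coef_map; case: pickP => /= [y /eqP /fmorph_inj //|/(_ f`_i)].
  by rewrite eqxx.
by rewrite nth_default.
Qed.

Section Multiplicative.

Variable chi : {poly Fq} -> algC.
Hypothesis chiM : forall f g, chi (f * g) = chi f * chi g.

(** [Lcoef n] is the coefficient of [T^n] in the L-function [L(T)] of [chi], and [Lpow r] that of
    [T^r] in [T L' / L]. *)
Definition Lcoef n := \sum_(v : 'rV[Fq]_n) chi (mon v).
Definition Lpow r := \sum_(x <- fixf K (q ^ r)) chi (descend (nrm r x)).

Lemma sum_dvdp_mon (g : {poly Fq}) r n : g \is monic -> size g = r.+1 -> (r <= n)%N ->
  \sum_(v : 'rV[Fq]_n | g %| mon v) chi (mon v) = chi g * Lcoef (n - r).
Proof.
move=> gm sg rn; have g0 := monic_neq0 gm.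
have multE (w : 'rV[Fq]_(n - r)) : mon (unmon n (g * mon w)) = g * mon w.
  rewrite unmonK ?monicMl ?mon_monic // size_monicM ?monic_neq0 ?mon_monic //.
  by rewrite sg mon_size addSn /= addnS subnKC.
have divE (v : 'rV[Fq]_n) : g %| mon v ->
    mon (unmon (n - r) (mon v %/ g)) = mon v %/ g.
  move=> gv; have E := divpK gv.
  have qm : mon v %/ g \is monic by have := mon_monic v; rewrite -{1}E monicMr.
  rewrite unmonK //; have := congr1 (fun f : {poly Fq} => size f) E.
  rewrite /= size_monicM // mon_size sg addnS /= => h.
  by rewrite -subSn // -h addnK.
rewrite /Lcoef mulr_sumr.
rewrite (reindex_onto (fun w => unmon n (g * mon w)) (fun v => unmon (n - r) (mon v %/ g))) /=.
  apply: eq_big => [w|w _]; last by rewrite multE chiM.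
  by rewrite multE dvdp_mulr // mulrC mulpK // monK eqxx.
by move=> v gv; rewrite divE // mulrC divpK // monK.
Qed.

(* By [sum_nrm_monic], every monic polynomial of degree [n] is a multiple of
   [nrm r x] for exactly [n] pairs [(r, x)] with [r <= n]. *)
Lemma newton n :
  n%:R * Lcoef n = \sum_(1 <= r < n.+1) Lpow r * Lcoef (n - r).
Proof.
rewrite /Lcoef mulr_sumr.
have E (v : 'rV[Fq]_n) : n%:R * chi (mon v) = \sum_(1 <= r < n.+1)
    \sum_(x <- fixf K (q ^ r)) (if nrm r x %| map_poly emb (mon v) then chi (mon v) else 0).
  rewrite -{1}(sum_nrm_monic (mon_monic v) (mon_size v)) natr_sum mulr_suml.
  apply: eq_bigr => r _; rewrite natr_sum mulr_suml; apply: eq_bigr => x _.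
  by case: ifP; rewrite ?mul1r ?mul0r.
under eq_bigr => v _ do rewrite E.
rewrite exchange_big /= !big_nat; apply: eq_bigr => r /andP[r0 rn].
rewrite exchange_big /= /Lpow mulr_suml big_seq [RHS]big_seq.
apply: eq_bigr => x; rewrite fixfP ?qX_gt1 // => /eqP /nrm_emb[g gm [sg gE]].
rewrite -gE descendK -(sum_dvdp_mon gm sg) // [RHS]big_mkcond /=.
by apply: eq_bigr => v _; rewrite dvdp_map.
Qed.

End Multiplicative.

(** * Vanishing of the coefficients of degree at least [p] *)

Lemma natr_inj_pchar (F : fieldType) (l l' : 'I_p) : p \in [pchar F] ->
  l%:R = l'%:R :> F -> l = l'.
Proof.
move=> pF; wlog ll : l l' / (l <= l')%N.
  by move=> W E; case: (leqP l l') => [/W->//|/ltnW/W->].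
move=> E; apply/val_inj/eqP; rewrite /= eqn_leq ll -subn_eq0.
have : (l' - l)%:R == 0 :> F by rewrite natrB // E subrr.
rewrite -(dvdn_pcharf pF) => pd; apply: contraT; rewrite -lt0n => ll0.
by have := dvdn_leq ll0 pd; rewrite leqNgt (leq_ltn_trans (leq_subr _ _)).
Qed.

Lemma pchar_Fq : p \in [pchar Fq].
Proof. by rewrite (card_finPcharP card_Fq). Qed.

(* [1 - (X - l)^(p - 1)] is [1] at [l] and vanishes on the rest of the prime
   field; adding multiples of it to monic polynomials rescales their value at
   [l] alone. *)
Lemma Lcoef_eq0 (psi : 'I_p -> Fq -> algC) n (l0 : 'I_p) (z : Fq) :
  (forall l x y, psi l (x * y) = psi l x * psi l y) ->
  z != 0 -> psi l0 z != 1 -> (p <= n)%N ->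
  Lcoef (fun f => \prod_(l < p) psi l f.[l%:R]) n = 0.
Proof.
move=> psiM z0 pz pn; set chi := fun f => _.
pose ell : {poly Fq} := 1 - ('X - l0%:R%:P) ^+ p.-1.
have p1 : (0 < p.-1)%N by rewrite -ltnS prednK ?prime_gt1 ?prime_gt0.
have ell_size : (size ell <= n)%N.
  rewrite (leq_trans (size_polyD _ _)) // size_polyN size_poly1 size_exp_XsubC.
  by rewrite prednK ?prime_gt0 // geq_max pn (leq_trans (prime_gt0 p_prime)).
have ellE y : ell.[y] = 1 - (y - l0%:R) ^+ p.-1 by rewrite /ell !hornerE.
have ell_l0 : ell.[l0%:R] = 1.
  by rewrite ellE subrr expr0n gtn_eqF // subr0.
have ell_l l : l != l0 -> ell.[l%:R] = 0.
  move=> ll; rewrite ellE.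
  have y0 : l%:R - l0%:R != 0 :> Fq.
    by apply: contra ll; rewrite subr_eq0 => /eqP/(natr_inj_pchar pchar_Fq) ->.
  apply/eqP; rewrite subr_eq0 eq_sym -(inj_eq (mulfI y0)) mulr1 -exprS prednK ?prime_gt0 //.
  by rewrite -(pFrobenius_autE pchar_Fq) rmorphB /= !pFrobenius_aut_nat.
(* Multiplies the value at [l0] by [w]. As [ell] has degree [p - 1 < n], the result is still monic
   of degree [n]; for [w = z] this permutes the summands and multiplies [chi] by [psi l0 z], which
   is not [1]. *)
pose upd (w : Fq) (v : 'rV[Fq]_n) : 'rV[Fq]_n := unmon n (mon v + ((w - 1) * (mon v).[l0%:R]) *: ell).
have updE y v : mon (upd y v) = mon v + ((y - 1) * (mon v).[l0%:R]) *: ell.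
  have s : (size (((y - 1) * (mon v).[l0%:R]) *: ell) < size (mon v))%N.
    by rewrite mon_size ltnS (leq_trans (size_scale_leq _ _)).
  apply: unmonK; last by rewrite size_polyDl // mon_size.
  by rewrite monicE lead_coefDl // -monicE mon_monic.
have updK y : y != 0 -> cancel (upd y) (upd y^-1).
  move=> y0 v; rewrite -[RHS]monK; congr (unmon n _).
  rewrite updE hornerD hornerZ ell_l0 mulr1 -addrA -scalerDl.
  rewrite [X in X *: _](_ : _ = 0) ?scale0r ?addr0 //.
  by field.
have updchi v : chi (mon (upd z v)) = psi l0 z * chi (mon v).
  rewrite /chi (bigD1 l0) //= [in RHS](bigD1 l0) //= mulrA; congr (_ * _).
    rewrite -psiM updE hornerD hornerZ ell_l0; congr (psi _ _); ring.
  apply: eq_bigr => l ll; rewrite updE hornerD hornerZ ell_l // mulr0 addr0 //.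
have : Lcoef chi n = psi l0 z * Lcoef chi n.
  rewrite {1}/Lcoef (reindex_onto (upd z) (upd z^-1)) /=; last first.
    by move=> v _; rewrite -{1}[z]invrK updK ?invr_eq0.
  rewrite mulr_sumr; apply: eq_big => [v|v _]; last exact: updchi.
  by rewrite updK ?eqxx.
move/eqP; rewrite -subr_eq0 -{1}[Lcoef _ _]mul1r -mulrBl mulf_eq0 subr_eq0 eq_sym.
by rewrite (negbTE pz) => /eqP.
Qed.

(** * Character sums over the translates by the prime field *)

Section Character.

Variables (m n0 : nat) (zeta : K) (eps : algC).
Hypotheses (m_gt0 : (0 < m)%N) (mn0 : (m * n0 = q.-1)%N).
Hypotheses (zeta_prim : m.-primitive_root zeta) (eps_prim : m.-primitive_root eps).

(** The isomorphism between the [m]-th roots of unity of [K] and those of [algC] that sends [zeta]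
    to [eps]. Any other [c] has index [m], hence the value [eps^m = 1], and the modulus is one
    everywhere. *)
Definition theta (c : K) : algC := eps ^+ index c [seq zeta ^+ i | i <- iota 0 m].

Lemma theta_zeta i : theta (zeta ^+ i) = eps ^+ i.
Proof.
rewrite /theta -(prim_expr_mod zeta_prim) -(prim_expr_mod eps_prim i).
have im : (i %% m < m)%N by rewrite ltn_pmod.
have -> : zeta ^+ (i %% m) = nth 0 [seq zeta ^+ i | i <- iota 0 m] (i %% m).
  by rewrite (nth_map 0%N) ?size_iota // nth_iota.
rewrite index_uniq ?size_map ?size_iota //.
rewrite map_inj_in_uniq ?iota_uniq // => a b.
rewrite !mem_iota !add0n /= => am bm /eqP.
by rewrite (eq_prim_root_expr zeta_prim) !modn_small // => /eqP.
Qed.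

Lemma zeta_rootP c : c ^+ m = 1 -> exists i, c = zeta ^+ i.
Proof. by move/(prim_rootP zeta_prim) => [i ->]; exists i. Qed.

Lemma theta1 : theta 1 = 1.
Proof. by rewrite -(expr0 zeta) theta_zeta expr0. Qed.

Lemma thetaM x y : x ^+ m = 1 -> y ^+ m = 1 -> theta (x * y) = theta x * theta y.
Proof.
by move=> /zeta_rootP[i ->] /zeta_rootP[j ->]; rewrite -exprD !theta_zeta exprD.
Qed.

Lemma norm_theta c : `|theta c| = 1.
Proof.
apply/eqP; rewrite -(@pexpr_eq1 _ _ m) // -normrX /theta -exprM mulnC exprM.
by rewrite (prim_expr_order eps_prim) expr1n normr1.
Qed.

Lemma theta_prod (I : finType) (y : I -> K) (a : I -> nat) :
  (forall l, y l ^+ m = 1) ->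
  theta (\prod_l y l ^+ a l) = \prod_l theta (y l) ^+ a l.
Proof.
move=> ym; suff [] : (\prod_l y l ^+ a l) ^+ m = 1 /\
  theta (\prod_l y l ^+ a l) = \prod_l theta (y l) ^+ a l by [].
apply: (big_rec2 (fun u v => u ^+ m = 1 /\ theta u = v)).
  by rewrite expr1n theta1.
move=> l u _ _ [um <-].
have [ylm ->] : (y l ^+ a l) ^+ m = 1 /\ theta (y l) ^+ a l = theta (y l ^+ a l).
  split; first by rewrite exprAC ym expr1n.
  have /zeta_rootP[i ->] := ym l.
  by rewrite theta_zeta -!exprM theta_zeta.
by rewrite exprMn ylm um mulr1 thetaM.
Qed.

(* Unlike the trivial character, [psi 0] vanishes at [0]. *)
Definition psi (a : nat) (x : Fq) : algC :=
  if x == 0 then 0 else theta (emb x ^+ n0) ^+ a.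

Lemma emb_root x : x != 0 -> (emb x ^+ n0) ^+ m = 1.
Proof.
move=> x0; rewrite -exprM mulnC mn0 -rmorphXn.
rewrite (_ : x ^+ q.-1 = 1) ?rmorph1 //.
by apply: (mulfI x0); rewrite mulr1 -exprS prednK ?(ltnW q_gt1) // -card_Fq expf_card.
Qed.

Lemma psiM a x y : psi a (x * y) = psi a x * psi a y.
Proof.
rewrite /psi mulf_eq0; case: eqVneq => [_|x0] /=; first by rewrite mul0r.
case: eqVneq => [_|y0]; first by rewrite mulr0.
by rewrite rmorphM exprMn thetaM ?exprMn ?emb_root.
Qed.

Definition chi (a : 'I_p -> nat) (f : {poly Fq}) : algC :=
  \prod_(l < p) psi (a l) f.[l%:R].

Lemma chiM a f g : chi a (f * g) = chi a f * chi a g.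
Proof.
by rewrite /chi -big_split; apply: eq_bigr => l _; rewrite hornerM psiM.
Qed.

Lemma natr_emb (l : nat) : emb l%:R = l%:R.
Proof. exact: rmorph_nat. Qed.

Lemma natr_frob r (l : nat) : (l%:R : K) ^+ (q ^ r) = l%:R.
Proof. by rewrite -(frobNE (pnat_q r)) rmorph_nat. Qed.

(** The norm from [F_(q^t)] to [F_q] is the power map with this exponent. *)
Definition geom t := (\sum_(i < t) q ^ i)%N.

Lemma geomE t : (q.-1 * geom t = (q ^ t).-1)%N.
Proof. by rewrite -predn_exp. Qed.

(** Transitivity of the norm through [F_(q^t)]; the factor [q^t + 1] becomes the [M + 1] of
    Stepanov's method. *)
Lemma geom_double t : geom (t + t) = (geom t * (q ^ t).+1)%N.
Proof.
rewrite /geom big_split_ord /= mulnS addnC mulnC big_distrr /=.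
by rewrite addnC; congr (_ + _)%N; apply: eq_bigr => i _; rewrite expnD.
Qed.

(** The value of [nrm r x] at [l] is the norm of [l - x], so [Lpow (chi a) r] is the sum over
    [F_(q^r)] of the characters lifted by the norm. *)
Lemma chi_nrm a r x : x ^+ (q ^ r) = x -> (forall l : 'I_p, x != l%:R) ->
  chi a (descend (nrm r x)) = \prod_(l < p) theta ((l%:R - x) ^+ (n0 * geom r)) ^+ a l.
Proof.
move=> /nrm_emb[g gm [sg gE]] xl; rewrite -gE descendK.
apply: eq_bigr => l _.
have E : emb g.[l%:R] = (l%:R - x) ^+ geom r.
  rewrite -horner_map /= natr_emb gE /nrm horner_prod /geom -prodrXr.
  apply: eq_bigr => i _; rewrite !hornerE -{1}(natr_frob i).
  by rewrite -!(frobNE (pnat_q i)) rmorphB.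
rewrite /psi -(fmorph_eq0 emb) E expf_eq0 subr_eq0 eq_sym (negbTE (xl l)) andbF.
by rewrite [(n0 * _)%N]mulnC exprM.
Qed.

Lemma chi_nrm0 a r x (l : 'I_p) : (0 < r)%N -> x ^+ (q ^ r) = x -> x = l%:R ->
  chi a (descend (nrm r x)) = 0.
Proof.
case: r => // r _ /nrm_emb[g gm [sg gE]] xl; rewrite -gE descendK.
rewrite /chi (bigD1 l) //= /psi -(fmorph_eq0 emb) -horner_map /= natr_emb gE.
by rewrite /nrm big_ord_recl hornerM expr1 xl !hornerE subrr !mul0r eqxx mul0r.
Qed.

Definition nonprime_pts r := [seq x <- fixf K (q ^ r) | [forall l : 'I_p, x != l%:R]].

Lemma Lpow_nonprime_pts a r : (0 < r)%N ->
  Lpow (chi a) r = \sum_(x <- nonprime_pts r) \prod_(l < p) theta ((l%:R - x) ^+ (n0 * geom r)) ^+ a l.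
Proof.
move=> r0; rewrite /Lpow /nonprime_pts big_filter big_seq [RHS]big_mkcond [RHS]big_seq.
apply: eq_bigr => x; rewrite fixfP ?qX_gt1 // => /eqP xr.
case: ifP => [/forallP xl|/negbT]; first exact: chi_nrm.
by rewrite negb_forall => /existsP[l /negPn/eqP]; apply: chi_nrm0.
Qed.

Lemma size_nonprime_pts r : (0 < r)%N -> (q ^ r <= size (nonprime_pts r) + p)%N.
Proof.
move=> r0; rewrite -{1}(@size_fixf K (q ^ r)) ?qX_gt1 ?pnat_q //.
rewrite -(count_predC (fun x => [forall l : 'I_p, x != l%:R]) (fixf _ _)).
rewrite -size_filter leq_add2l -size_filter -[X in (_ <= X)%N]card_ord cardE.
rewrite -(size_map (fun l : 'I_p => l%:R : K)); apply: uniq_leq_size.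
  by rewrite filter_uniq ?fixf_uniq.
move=> x; rewrite mem_filter /= negb_forall => /andP[/existsP[l /negPn/eqP ->] _].
by apply/mapP; exists l; rewrite ?mem_enum.
Qed.

Lemma sum_root_of_unity (F : fieldType) (c : F) j :
  c ^+ j = 1 -> c != 1 -> \sum_(i < j) c ^+ i = 0.
Proof.
move=> cj c1; have /eqP := subrX1 c j; rewrite cj subrr eq_sym mulf_eq0.
by rewrite subr_eq0 (negbTE c1) => /eqP.
Qed.

(** Supplies an element on which [psi a] differs from [1] for all [0 < a < m], as [Lcoef_eq0]
    requires. *)
Lemma exists_zeta_root : exists2 z : Fq, z != 0 & emb z ^+ n0 = zeta.
Proof.
have n00 : (0 < n0)%N.
  rewrite lt0n; apply: contraTneq q_gt1 => n0E.
  by move: mn0; rewrite n0E muln0; case: (p ^ k)%N => [|[]].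
have [y yz] := closed_field_root zeta n00.
have yq1 : y ^+ q.-1 = 1 by rewrite -mn0 mulnC exprM yz (prim_expr_order zeta_prim).
have [z zy] : exists z, y = emb z.
  apply: fixed_emb; rewrite -[X in y ^+ X]prednK ?(ltnW q_gt1) //.
  by rewrite exprS yq1 mulr1.
exists z; last by rewrite -zy.
rewrite -(fmorph_eq0 emb) -zy; apply: contraTneq (oner_neq0 K) => y0.
by rewrite -yq1 y0 expr0n -(subnKC q_gt1) eqxx.
Qed.

Lemma pnat_pcharX r : [pchar {poly K}].-nat (q ^ r)%N.
Proof. by rewrite (eq_pnat _ (pchar_poly K)) pnat_q. Qed.

Lemma prime_field_poly_frob (a : 'I_p -> nat) r
    (f := \prod_(l < p) ((l%:R : {poly K}) - 'X) ^+ a l) :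
  f ^+ (q ^ r) = f \Po 'X^(q ^ r).
Proof.
rewrite /f -(frobNE (pnat_pcharX r)) rmorph_prod /= rmorph_prod /=.
apply: eq_bigr => l _; rewrite !rmorphXn /= !rmorphB /= !rmorph_nat.
by rewrite comp_polyX frobNE.
Qed.

Lemma mup_prime_field_poly (a : 'I_p -> nat) (l : 'I_p) :
  mup l%:R (\prod_(l < p) ((l%:R : {poly K}) - 'X) ^+ a l) = a l.
Proof.
have E (l' : 'I_p) : (l'%:R : {poly K}) - 'X = (-1)%:P * ('X - l'%:R%:P).
  by rewrite polyCN mulN1r opprB polyC_natr.
have neq0 (l' : 'I_p) : (l'%:R : {poly K}) - 'X != 0.
  by rewrite E mulf_neq0 ?polyXsubC_eq0 // polyC_eq0 oppr_eq0 oner_eq0.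
have root' (l' : 'I_p) : root ((l'%:R : {poly K}) - 'X) l%:R = (l' == l).
  rewrite E rootM rootC oppr_eq0 oner_eq0 root_XsubC.
  apply/eqP/eqP => [/(natr_inj_pchar pchar_closure)//|->//].
rewrite (bigD1 l) //= mupMl.
  rewrite mup_exp // E mupMr ?rootC ?oppr_eq0 ?oner_eq0 //.
  by rewrite -[X in mup _ X]expr1 mup_XsubCX eqxx muln1.
rewrite /root horner_prod; apply/prodf_neq0 => l' ll.
rewrite horner_exp expf_neq0 // -[_ == 0]/(root _ _) root' //.
Qed.

(* The tuple [a] is first divided by its greatest common divisor with [m], which
   makes [Z^m' - f] irreducible. *)
Lemma char_sum_bound (a : 'I_p -> nat) (l0 : 'I_p) : (0 < a l0 < m)%N ->
  exists C : nat, forall t, (0 < t)%N ->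
  `|Lpow (chi a) (t + t)| <= C%:R * q%:R ^+ t.
Proof.
move=> /andP[al0 alm].
pose G := \big[gcdn/m]_(l < p) a l.
have Gm : (G %| m)%N.
  by apply: (big_rec (fun x => x %| m)%N) => // l x _; apply: dvdn_trans (dvdn_gcdr _ _).
have Ga l : (G %| a l)%N.
  by rewrite /G (bigD1 l) // dvdn_gcdl.
have G0 : (0 < G)%N := dvdn_gt0 m_gt0 Gm.
pose m' := (m %/ G)%N; pose a' l := (a l %/ G)%N.
have mE : (m' * G = m)%N by rewrite divnK.
have aE l : (a' l * G = a l)%N by rewrite divnK.
have m'1 : (1 < m')%N.
  rewrite ltn_divRL // mul1n (leq_ltn_trans _ alm) // dvdn_leq //.
have m'0 := ltnW m'1.
pose f := \prod_(l < p) ((l%:R : {poly K}) - 'X) ^+ a' l.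
have Hf d : (0 < d < m')%N -> exists c, ~~ (m' %| d * mup c f)%N.
  move=> /andP[d0 dm].
  suff /existsP[l ml] : [exists l : 'I_p, ~~ (m' %| d * a' l)%N].
    by exists l%:R; rewrite mup_prime_field_poly.
  rewrite -negb_forall; apply/negP => /forallP H.
  have : (m %| d * G)%N.
    apply: (big_ind (fun x => m %| d * x)%N) => [|x y mx my|l _].
    - exact: dvdn_mull.
    - by rewrite muln_gcdr dvdn_gcd mx.
    - by rewrite -aE -mE mulnA dvdn_pmul2r // H.
  by rewrite -mE dvdn_pmul2r // => /(dvdn_leq d0); rewrite leqNgt dm.
have f0 : f != 0.
  apply/prodf_neq0 => l _; rewrite expf_neq0 //.
  by rewrite -opprB oppr_eq0 -polyC_natr polyXsubC_eq0.
pose z' := zeta ^+ G; pose mu := [seq z' ^+ i | i <- iota 0 m'].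
have GE : gcdn G m = G by apply/gcdn_idPl.
have z'p : m'.-primitive_root z' by have := exp_prim_root zeta_prim G; rewrite GE.
have e'p : m'.-primitive_root (eps ^+ G) by have := exp_prim_root eps_prim G; rewrite GE.
have umu : uniq mu.
  rewrite map_inj_in_uniq ?iota_uniq // => i j.
  rewrite !mem_iota !add0n /= => im jm /eqP.
  by rewrite (eq_prim_root_expr z'p) !modn_small // => /eqP.
have muP c : (c \in mu) = (c ^+ m' == 1).
  apply/mapP/eqP => [[i _ ->]|]; first by rewrite exprAC (prim_expr_order z'p) expr1n.
  by move/(prim_rootP z'p) => [i ->]; exists (val i); rewrite ?mem_iota ?add0n ?ltn_ord.
have smu : size mu = m' by rewrite size_map size_iota.
have [||C HC] := @kummer_sum_bound K m' f mu theta m'1 f0 Hf umu smu muP.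
- by move=> c _; rewrite norm_theta.
- rewrite big_map (_ : iota 0 m' = index_iota 0 m') ?big_mkord; last by rewrite /index_iota subn0.
  have e'1 : eps ^+ G != 1.
    by rewrite -[eps ^+ G]expr1 -(prim_order_dvd e'p) dvdn1 gtn_eqF.
  rewrite -[RHS](sum_root_of_unity (prim_expr_order e'p) e'1).
  by apply: eq_bigr => i _; rewrite /z' -!exprM theta_zeta.
(* The summand [p] accounts for the prime field, which [nonprime_pts] leaves out. *)
exists (C + p)%N => t t0.
(* Chosen so that [m' * n + 1 = q^t], which is the [M] of Stepanov's method for the field with
   [q^(2t)] elements. *)
pose n := (G * (n0 * geom t))%N.
have mn : (m' * n = (q ^ t).-1)%N by rewrite /n mulnA mE mulnA mn0 geomE.
have qt1 := qX_gt1 t0.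
have M : (m' * n).+1 = (q ^ t)%N by rewrite mn prednK // ltnW.
rewrite Lpow_nonprime_pts ?addn_gt0 ?t0 //.
have -> : \sum_(x <- nonprime_pts (t + t)) \prod_(l < p) theta ((l%:R - x) ^+ (n0 * geom (t + t))) ^+ a l
   = \sum_(x <- nonprime_pts (t + t)) theta (f.[x] ^+ (n * (m' * n).+2)).
  rewrite big_seq [RHS]big_seq; apply: eq_bigr => x.
  rewrite mem_filter fixfP ?qX_gt1 ?addn_gt0 ?t0 // => /andP[/forallP xl /eqP xq].
  rewrite -theta_prod => [|l].
    congr theta; rewrite M /f horner_prod -prodrXl; apply: eq_bigr => l _.
    rewrite horner_exp hornerD hornerN hornerX -polyC_natr hornerC -!exprM; congr (_ ^+ _).
    by rewrite geom_double -aE /n; ring.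
  have lx : l%:R - x != 0 by rewrite subr_eq0 eq_sym.
  apply: (mulfI lx); rewrite mulr1 -exprM -exprS.
  rewrite mulnC mulnA mn0 geomE prednK ?(ltnW (qX_gt1 _)) ?addn_gt0 ?t0 //.
  by rewrite -(frobNE (pnat_q _)) rmorphB rmorph_nat /= frobNE xq.
have H := HC n p (nonprime_pts (t + t)); rewrite M in H *.
apply: (le_trans (H _ _ _ _ _ _)).
- by rewrite lt0n; apply: contraTneq qt1 => n00; rewrite -M n00 muln0.
- exact: pnat_q.
- exact: prime_field_poly_frob.
- by rewrite filter_uniq ?fixf_uniq.
- move=> x; rewrite mem_filter fixfP ?qX_gt1 ?addn_gt0 ?t0 // => /andP[/forallP xl /eqP xq].
  split; first by rewrite -[RHS]xq expnD.
  rewrite /f horner_prod; apply/prodf_neq0 => l _.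
  rewrite horner_exp hornerD hornerN hornerX -polyC_natr hornerC expf_neq0 //.
  by rewrite subr_eq0 eq_sym.
- by rewrite -expnD size_nonprime_pts // addn_gt0 t0.
rewrite -natrX -natrM ler_nat mulnDl leq_add2l leq_pmulr // expn_gt0.
by rewrite (ltnW q_gt1).
Qed.

Lemma Lpow1_bound (a : 'I_p -> nat) (l0 : 'I_p) : (0 < a l0 < m)%N ->
  `|Lpow (chi a) 1| <= p.-1%:R * sqrtC q%:R.
Proof.
move=> al; have [C HC] := char_sum_bound al.
have L0 : Lcoef (chi a) 0 = 1.
  rewrite /Lcoef (eq_bigr (fun _ => 1)) => [|v _].
    by rewrite sumr_const card_mx muln0 expn0.
  have -> : mon v = 1.
    apply/eqP; rewrite -[mon v]/(mon v) eq_sym; apply/eqP.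
    by have := mon_monic v; have /eqP/size_poly1P[c _ ->] := mon_size v; rewrite monicE lead_coefC => /eqP ->.
  by rewrite /chi big1 // => l _; rewrite hornerC /psi oner_eq0 rmorph1 expr1n theta1 expr1n.
have [z z0 zz] := exists_zeta_root.
have LN n : (p.-1 < n)%N -> Lcoef (chi a) n = 0.
  move=> pn; apply: (@Lcoef_eq0 (fun l => psi (a l)) n l0 z) => //.
  - by move=> l x y; exact: psiM.
  - rewrite /psi (negbTE z0) zz -[zeta]expr1 theta_zeta expr1 -(prim_order_dvd eps_prim).
    by case/andP: al => al0 alm; rewrite gtnNdvd.
  - by rewrite -(prednK (prime_gt0 p_prime)).
have [s ss Ls] := power_sum_of_newton L0 LN (newton (chiM a)).
have B0 : (0 : algC) < q%:R by rewrite ltr0n ltnW ?q_gt1.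
(* The estimate is available for even exponents only, hence the passage to the squares of the [w]
   and to [q] in place of its root. *)
have Hs t : (0 < t)%N -> `|\sum_(v <- [seq w ^+ 2 | w <- s]) v ^+ t| <= C%:R * q%:R ^+ t.
  move=> t0; rewrite big_map (eq_bigr (fun w => w ^+ (t + t))) => [|w _]; last first.
    by rewrite -exprM mul2n addnn.
  by have := HC t t0; rewrite Ls ?addn_gt0 ?t0 // normrN.
have sq0 : 0 <= sqrtC (q%:R : algC) by rewrite sqrtC_ge0 ltW.
have ws w : w \in s -> `|w| <= sqrtC q%:R.
  move=> wsw; have := power_sum_eigenvalue_bound B0 Hs (map_f _ wsw).
  by rewrite normrX -{1}[q%:R]sqrtCK ler_pXn2r ?nnegrE.
rewrite Ls // normrN (le_trans (ler_norm_sum _ _ _)) //.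
apply: (@le_trans _ _ (\sum_(w <- s) sqrtC q%:R)).
  by rewrite !big_seq; apply: ler_sum => w /ws; rewrite expr1.
by rewrite big_const_seq iter_addr_0 count_predT -[sqrtC _ *+ _]mulr_natl ler_wpM2r ?ler_nat //.
Qed.

(** * Orthogonality and the existence of [y] *)

Lemma sum_theta (c : K) : c ^+ m = 1 ->
  \sum_(j < m) theta c ^+ j = if c == 1 then m%:R else 0.
Proof.
case: eqVneq => [-> _|c1 cm].
  by rewrite theta1 (eq_bigr (fun=> 1)) ?sumr_const ?card_ord // => j _; rewrite expr1n.
have [i ci] := zeta_rootP cm; apply: sum_root_of_unity.
  by rewrite ci theta_zeta exprAC (prim_expr_order eps_prim) expr1n.
apply: contra c1; rewrite ci theta_zeta -(prim_order_dvd eps_prim).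
by rewrite -(prim_order_dvd zeta_prim).
Qed.

(** Exchanging the sums, a point [x] contributes a product over [l] of complete character sums; by
    orthogonality one factor vanishes as soon as one [l - x] is not an [n0]-th root of unity. *)
Lemma sum_Lpow1_eq0 :
  (forall x, x \in nonprime_pts 1 -> exists l : 'I_p, (l%:R - x) ^+ n0 != 1) ->
  \sum_(a : {ffun 'I_p -> 'I_m}) Lpow (chi (fun l => a l)) 1 = 0.
Proof.
move=> none; under eq_bigr => a _ do rewrite Lpow_nonprime_pts //.
rewrite exchange_big /= big_seq big1 // => x xE.
rewrite -(bigA_distr_bigA (fun (l : 'I_p) (j : 'I_m) => theta ((l%:R - x) ^+ (n0 * geom 1)) ^+ j)).
have [l xl] := none x xE; rewrite (bigD1 l) //= sum_theta.
  by rewrite /geom big_ord1 expn0 muln1 (negbTE xl) mul0r.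
move: xE; rewrite mem_filter fixfP ?qX_gt1 // => /andP[/forallP xF /eqP xq].
have lx : l%:R - x != 0 by rewrite subr_eq0 eq_sym.
apply: (mulfI lx); rewrite mulr1 -exprM -exprS mulnC mulnA mn0 geomE prednK ?(ltnW (qX_gt1 _)) //.
by rewrite -(frobNE (pnat_q 1)) rmorphB rmorph_nat /= frobNE xq.
Qed.

Lemma exists_translates : ((m ^ p * p.-1) ^ 2 <= q.-1)%N -> q <> 2%N ->
  exists y : Fq, forall l : 'I_p, (y + l%:R) ^+ n0 = 1.
Proof.
move=> bnd q2.
suff [x xE xl] : exists2 x, x \in nonprime_pts 1 & forall l : 'I_p, (l%:R - x) ^+ n0 = 1.
  move: xE; rewrite mem_filter fixfP ?qX_gt1 // expn1 => /andP[_ /eqP/fixed_emb[y xy]].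
  exists (- y) => l; apply: (fmorph_inj emb).
  by rewrite rmorphXn rmorphD rmorphN /= natr_emb -xy addrC xl rmorph1.
have [/hasP[x xE /forallP xl]|/hasPn none] :=
  boolP (has (fun x => [forall l : 'I_p, (l%:R - x) ^+ n0 == 1]) (nonprime_pts 1)).
  by exists x => // l; apply/eqP.
have : \sum_(a : {ffun 'I_p -> 'I_m}) Lpow (chi (fun l => a l)) 1 = 0.
  apply: sum_Lpow1_eq0 => x /none; rewrite negb_forall => /existsP[l xl].
  by exists l.
pose a0 : {ffun 'I_p -> 'I_m} := [ffun=> Ordinal m_gt0].
have -> : \sum_(a : {ffun 'I_p -> 'I_m}) Lpow (chi (fun l => a l)) 1 =
    (size (nonprime_pts 1))%:R + \sum_(a | a != a0) Lpow (chi (fun l => a l)) 1.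
  rewrite (bigD1 a0) //=; congr (_ + _); rewrite Lpow_nonprime_pts //.
  rewrite (eq_bigr (fun=> 1)) => [|x _].
    by rewrite big_const_seq count_predT iter_addr_0.
  by rewrite big1 // => l _; rewrite ffunE expr0.
move/eqP; rewrite addr_eq0 => /eqP E.
set s : algC := sqrtC q%:R; set P := p.-1.
have s2 : s ^+ 2 = q%:R by rewrite sqrtCK.
have q0 : (0 : algC) < q%:R by rewrite ltr0n ltnW ?q_gt1.
have s0 : 0 < s by rewrite sqrtC_gt0.
have szle : (size (nonprime_pts 1))%:R <= (m ^ p - 1)%N%:R * (P%:R * s).
  rewrite -[leLHS]ger0_norm ?ler0n // E normrN (le_trans (ler_norm_sum _ _ _)) //.
  apply: (@le_trans _ _ (\sum_(a : {ffun 'I_p -> 'I_m} | a != a0) P%:R * s)).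
    apply: ler_sum => a aa0.
    have [l al] : exists l, a l != Ordinal m_gt0.
      apply/existsP; apply: contraNT aa0; rewrite negb_exists => /forallP aE.
      by apply/eqP/ffunP => l; rewrite ffunE; apply/eqP/negPn/aE.
    apply: (@Lpow1_bound _ l); rewrite ltn_ord andbT lt0n.
    by apply: contra al => /eqP al; apply/eqP/val_inj.
  rewrite sumr_const -[_ *+ _]mulr_natl ler_wpM2r ?mulr_ge0 ?ler0n ?(ltW s0) // ler_nat.
  by rewrite (cardC1 a0) card_ffun !card_ord subn1.
have Xs : (m ^ p * P)%N%:R < s.
  rewrite -(@ltr_pXn2r _ 2) ?nnegrE ?ler0n ?(ltW s0) // s2 -natrX ltr_nat.
  by rewrite (leq_ltn_trans bnd) // prednK // ltnW ?q_gt1.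
have Xss : (m ^ p * P)%N%:R * s < q%:R by rewrite -s2 expr2 ltr_pM2r.
have mp : (1 <= m ^ p)%N by rewrite expn_gt0 m_gt0.
have qle : q%:R <= (size (nonprime_pts 1))%:R + p%:R :> algC.
  by rewrite -natrD ler_nat -{1}[q]expn1 size_nonprime_pts.
(* The trivial tuple is not estimated, which saves one term [P * s]; since [m^p * P * s < q], this
   is what remains of the lower bound [q - p] for the number of points. *)
have Pp : P%:R * s < p%:R.
  have : q%:R + P%:R * s < q%:R + p%:R.
    apply: (le_lt_trans (lerD (le_trans qle (lerD szle (lexx _))) (lexx _))).
    rewrite -addrA [p%:R + _]addrC addrA ltrD2r.
    apply: le_lt_trans Xss; rewrite natrB // natrM mulrBl mul1r mulrA subrK.
    exact: lexx.
  by rewrite ltrD2l.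
have : (P ^ 2 * q < p ^ 2)%N.
  rewrite -(ltr_nat algC) natrM -s2 [(P ^ 2)%:R]natrX [(p ^ 2)%:R]natrX -exprMn.
  by rewrite ltr_pXn2r // nnegrE ?ler0n // mulr_ge0 ?ler0n // ltW.
have p1 := prime_gt1 p_prime.
have qp : (p <= q)%N by rewrite -{1}[p]expn1 leq_pexp2l // prime_gt0.
(* For [p > 2] the inequality [(p - 1)^2 q < p^2] already contradicts [p <= q]. *)
have small (u v : nat) : (1 < u)%N -> (u < v)%N -> (u ^ 2 * v < u.+1 ^ 2)%N -> False.
  move=> u1 uv; apply/negP; rewrite -leqNgt.
  apply: (@leq_trans (u ^ 2 * u.+1)); last by rewrite leq_mul2l uv orbT.
  by rewrite -!mulnn leq_mul2r /=; nia.
have [p2|p2] := ltnP 2 p.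
  have PE : P.+1 = p by rewrite prednK // prime_gt0.
  by move=> h; case: (small P q); rewrite ?PE // -ltnS PE.
(* For [p = 2] the inequality reads [q < 4] and leaves only the excluded value [q = 2]. *)
have {}p2 : p = 2%N by apply/eqP; rewrite eqn_leq p2.
move=> h; exfalso; move: h; rewrite /P p2 mul1n.
case: k k_gt0 q2 => [//|[|j]] _; rewrite p2 // => _.
by rewrite ltn_exp2l.
Qed.

End Character.
End Newton.

(** * The Lie algebra *)

Section ShiftLieAlgebra.

Variables (F : fieldType) (p : nat).
Hypothesis p_char : p \in [pchar F].

Definition shift (v : 'rV[F]_p) : 'rV[F]_p := \row_i v 0 (ord_pred i).

Definition shift_space : vectType F := (F^o * 'rV[F]_p * F^o)%type.

Definition shift_br (x y : shift_space) : shift_space :=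
  (0, x.1.1 *: shift y.1.2 - y.1.1 *: shift x.1.2, 0).

Lemma shift_space_lin c (x z : shift_space) :
  ((c *: x + z).1.1 = c * x.1.1 + z.1.1 :> F) *
  ((c *: x + z).1.2 = c *: x.1.2 + z.1.2) *
  ((c *: x + z).2 = c * x.2 + z.2 :> F).
Proof. by []. Qed.

Lemma shift_br_linearl y : linear (shift_br^~ y).
Proof.
move=> c x z; rewrite /shift_br !shift_space_lin; congr (_, _, _) => /=; rewrite ?scaler0 ?addr0 //.
by apply/rowP => i; rewrite !mxE /=; ring.
Qed.

Lemma shift_br_linearr x : linear (shift_br x).
Proof.
move=> c y z; rewrite /shift_br !shift_space_lin; congr (_, _, _) => /=; rewrite ?scaler0 ?addr0 //.
by apply/rowP => i; rewrite !mxE /=; ring.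
Qed.

Lemma shift_br_alt x : shift_br x x = 0.
Proof. by rewrite /shift_br subrr. Qed.

Lemma shift_br_jacobi x y z :
  shift_br x (shift_br y z) + shift_br y (shift_br z x) + shift_br z (shift_br x y) = 0.
Proof.
rewrite /shift_br; congr (_, _, _) => /=; rewrite ?addr0 //.
by apply/rowP => i; rewrite !mxE /=; ring.
Qed.

Definition shift_lie : lieAlgebra F :=
  LieAlgebra shift_br_linearl shift_br_linearr shift_br_alt shift_br_jacobi.

(** The all-one vector is fixed by the cyclic shift, so bracketing it with the acting line
    reproduces it in every term of the lower central series. *)
Lemma shift_lie_not_nilpotent : ~ lie_nilpotent shift_lie.
Proof.
case=> c c0; pose z : shift_lie := (0, const_mx 1, 0).
have zc : z \in lower_central shift_lie c.
  elim: c {c0} => [|c IH]; first exact: memvf.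
  have -> : z = lie_br z ((-1, 0, 0) : shift_lie).
    rewrite /= /shift_br /=; congr (_, _, _).
    by apply/rowP => i; rewrite !mxE /= mul0r sub0r mulN1r opprK.
  have [sub _] := brackv_sub (lower_central shift_lie c) fullv
    (lower_central shift_lie c.+1).
  by apply: (sub (subvv _)); rewrite ?memvf.
move: zc; rewrite c0 memv0 => /eqP/(congr1 (fun x : shift_lie => x.1.2)) /=.
have p0 : (0 < p)%N := prime_gt0 (pcharf_prime p_char).
move/rowP/(_ (Ordinal p0)); rewrite !mxE => /eqP.
by rewrite oner_eq0.
Qed.

Variables (alpha gamma : F).

Definition shift_der_fun (x : shift_lie) : shift_lie :=
  (x.1.1, \row_i ((alpha + (i : nat)%:R) * x.1.2 0 i), gamma * x.2).

Lemma shift_der_linear : linear shift_der_fun.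
Proof.
move=> c x y; rewrite /shift_der_fun !shift_space_lin; congr (_, _, _) => /=.
  by apply/rowP => i; rewrite !mxE /=; ring.
by rewrite mulrDr /GRing.scale /= mulrCA.
Qed.

HB.instance Definition _ := GRing.isLinear.Build F shift_lie shift_lie _
  shift_der_fun shift_der_linear.

Definition shift_der : 'End(shift_lie) := linfun shift_der_fun.

Lemma natr_ord_pred (i : 'I_p) : (ord_pred i)%:R + 1 = (i : nat)%:R :> F.
Proof.
have p0 : (0 < p)%N := prime_gt0 (pcharf_prime p_char).
rewrite /= GRing.natr_mod_pchar // natr1 prednK ?natrD ?(pcharf0 p_char) ?addr0 //.
by rewrite addn_gt0 p0 orbT.
Qed.

(** The shift carries the eigenvalue [alpha + i - 1] to [alpha + i], which matches the eigenvalue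
    [1] on the acting line. The wrap from [p - 1] to [0] is consistent because [p = 0] in [F]. *)
Lemma shift_der_derivation : lie_derivation shift_der.
Proof.
move=> x y; rewrite !lfunE /= /shift_der_fun /= /shift_br /=.
congr (_, _, _) => /=; rewrite ?mulr0 ?addr0 //.
by apply/rowP => i; rewrite !mxE /= -natr_ord_pred; ring.
Qed.

Lemma iter_shift_der n x : iter n shift_der x =
  (x.1.1, \row_i ((alpha + (i : nat)%:R) ^+ n * x.1.2 0 i), gamma ^+ n * x.2)
  :> shift_lie.
Proof.
elim: n => [|n IH] /=.
  case: x => [[t v] w] /=; rewrite expr0 mul1r; congr (_, _, _).
  by apply/rowP => i; rewrite mxE expr0 mul1r.
rewrite IH lfunE /= /shift_der_fun /=; congr (_, _, _); last by rewrite exprS mulrA.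
by apply/rowP => i; rewrite !mxE exprS mulrA.
Qed.

Lemma shift_der_order n : n.-primitive_root gamma ->
  (forall i : 'I_p, (alpha + (i : nat)%:R) ^+ n = 1) -> has_order shift_der n.
Proof.
move=> gn an; split; first exact: prim_order_gt0 gn.
  move=> [[t v] w]; rewrite iter_shift_der (prim_expr_order gn) mul1r.
  by congr (_, _, _); apply/rowP => i; rewrite mxE an mul1r.
move=> j /andP[j0 jn] /(_ (0, 0, 1)); rewrite iter_shift_der => -[_].
move/eqP; rewrite mulr1 -(prim_order_dvd gn) => /(dvdn_leq j0).
by rewrite leqNgt jn.
Qed.

Lemma has_order_inj n : has_order shift_der n -> injective shift_der.
Proof.
case: n => [[]//|n] [_ Dn _] x y E.
by rewrite -[x]Dn -[y]Dn !iterSr E.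
Qed.

End ShiftLieAlgebra.

Lemma prime_field_translates_N_ (F : fieldType) (p n : nat) (alpha gamma : F) :
  p \in [pchar F] -> n.-primitive_root gamma ->
  (forall i : 'I_p, (alpha + i%:R) ^+ n = 1) -> N_ p n.
Proof.
move=> pF gn an; have Do := shift_der_order gn an.
exists F, (shift_lie F p), (shift_der p alpha gamma); split=> //.
- exact: shift_lie_not_nilpotent.
- exact: shift_der_derivation.
- exact: has_order_inj Do.
Qed.

(** The [2p]-th power clears the exponents: [(p - 1)^2 (q - 1)^(2p - 1) <= n^(2p)]. Multiply by
    [m^(2p)], use [m n = q - 1], and cancel [(q - 1)^(2p - 1)]. *)
Lemma real_bound_to_nat (R : realType) (p q m n : nat) : (0 < p)%N -> (1 < q)%N ->
  (m * n = q.-1)%N ->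
  (p%:R - 1) `^ (p%:R^-1) * (q%:R - 1) `^ (1 - (2 * p%:R)^-1) <= n%:R :> R ->
  ((m ^ p * p.-1) ^ 2 <= q.-1)%N.
Proof.
move=> p0 q1 mn; have PE : p%:R - 1 = p.-1%:R :> R by rewrite -subn1 natrB.
have QE : q%:R - 1 = q.-1%:R :> R by rewrite -subn1 natrB // ltnW.
rewrite PE QE => H; have Q0 : (0 < q.-1)%N by rewrite -ltnS prednK // ltnW.
have p2 : (0 < 2 * p)%N by rewrite muln_gt0.
have pR : p%:R != 0 :> R by rewrite pnatr_eq0 -lt0n.
have : (p.-1%:R `^ (p%:R^-1) * q.-1%:R `^ (1 - (2 * p%:R)^-1)) ^+ (2 * p) <= n%:R ^+ (2 * p) :> R.
  by rewrite ler_pXn2r ?nnegrE ?mulr_ge0 ?powR_ge0 ?ler0n.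
rewrite exprMn -!powR_mulrn ?powR_ge0 -?powRrM ?ler0n //.
have -> : p%:R^-1 * (2 * p)%:R = 2%:R :> R by rewrite natrM; field.
have -> : (1 - (2 * p%:R)^-1) * (2 * p)%:R = (2 * p).-1%:R :> R.
  rewrite -subn1 natrB // natrM; field.
  by [].
rewrite !powR_mulrn ?ler0n // -!natrX -natrM ler_nat => E.
have : (m ^ (2 * p) * (p.-1 ^ 2 * q.-1 ^ (2 * p).-1) <= q.-1 ^ (2 * p))%N.
  by rewrite -[in X in (_ <= X)%N]mn [in X in (_ <= X)%N]expnMn leq_mul2l E orbT.
rewrite -[X in (_ <= _ ^ X)%N](prednK p2) [(q.-1 ^ _.+1)%N]expnS mulnA leq_pmul2r ?expn_gt0 ?Q0 //.
by rewrite expnMn -expnM [(p * 2)%N]mulnC.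
Qed.

Theorem corollary2p5 (R : realType) (p q k n : nat)
  (hp : prime p) (hk : (0 < k)%N) (hq : q = (p ^ k)%N)
  (hq2 : q <> 2%N)
  (hn : (0 < n)%N) (hdiv : (n %| q - 1)%N)
  (hbound : n%:R >= (p%:R - 1) `^ (p%:R^-1) *
                    (q%:R - 1) `^ (1 - (2 * p%:R)^-1) :> R) :
  N_ p n.
Proof.
have [Fq pFq cardF] := pPrimePowerField hp hk.
have [K [emb _]] := countable_algebraic_closure Fq.
have q1 : (1 < q)%N by rewrite hq -cardF finNzRing_gt1.
pose m := ((q - 1) %/ n)%N.
have mn : (m * n = q.-1)%N by rewrite divnK // subn1.
have q0 : (0 < q.-1)%N by rewrite -ltnS prednK // ltnW.
have m0 : (0 < m)%N by move: q0; rewrite -mn muln_gt0 => /andP[].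
have /hasP[g _ gp] : has (q.-1).-primitive_root [seq x <- enum Fq | x != 0].
  apply: cyclic.has_prim_root => //.
  - apply/allP => x; rewrite mem_filter unity_rootE => /andP[x0 _].
    by rewrite -(inj_eq (mulfI x0)) mulr1 -exprS prednK ?(ltnW q1) // hq -cardF expf_card.
  - by rewrite filter_uniq ?enum_uniq.
  - have := count_predC (pred1 (0 : Fq)) (enum Fq).
    rewrite (count_uniq_mem _ (enum_uniq _)) mem_enum inE -cardE cardF -hq => <-.
    by rewrite size_filter.
(* One generator [g] of the multiplicative group serves twice: [g^n], of order [m], defines the
   characters, and [g^m], of order [n], is the eigenvalue on the central summand. *)
have zp : m.-primitive_root (emb (g ^+ n)).
  rewrite fmorph_primitive_root -[X in _ ^+ X](mulKn n m0) mn.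
  by rewrite (dvdn_prim_root gp) // -mn dvdn_mulr.
have np : n.-primitive_root (g ^+ m).
  by rewrite -[X in _ ^+ X](mulnK m hn) mn (dvdn_prim_root gp) // -mn dvdn_mull.
have [eps ep] := C_prim_root_exists m0.
have bnd := real_bound_to_nat (prime_gt0 hp) q1 mn hbound.
rewrite hq in mn bnd hq2.
have [y Hy] := exists_translates emb hp hk cardF m0 mn zp ep bnd hq2.
exact: prime_field_translates_N_ pFq np Hy.
Qed.
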